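(* Let $\ell\geqslant1$ be an integer, $c\in\mathbb{R}\setminus\{0\}$ and $\varepsilon\in\{-1,1\}$. If $c<0$, assume that $\varepsilon=1$. Then there exist rotationally invariant generalized Ricci metrics of type $(-2\ell,0,c)$ on a sphere such that $\operatorname{sign}(K-c)=\varepsilon$, where $K$ is the curvature. Moreover, there exist infinitely many such metrics on a sphere that are not isometric one to another.
   Context: Smooth means of class $C^\infty$. For $(a,b,c)\in\mathbb{R}^3$, a smooth Riemannian metric on a surface, with Gaussian curvature $K$, is a generalized Ricci metric of type $(a,b,c)$ if $(c-K)\Delta K+\|\nabla K\|^2+(aK+b)(K-c)^2=0$, where $\Delta=\operatorname{div}\nabla$. For a real-valued function $F$, $\operatorname{sign}F=1$ (resp. $\operatorname{sign}F=-1$) means $F\geqslant0$ and $F\not\equiv0$ (resp. $F\leqslant0$ and $F\not\equiv0$). Rotationally invariant: on the sphere viewed as the Riemann sphere $\mathbb{C}\cup\{\infty\}$, the metric is conformal and invariant under the rotations $z\mapsto e^{i\theta}z$, $\theta\in\mathbb{R}$. *)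

(* Defs.v *)
(* Classical reals of Stdlib with Coquelicot. *)
From Stdlib Require Import Reals.
From Coquelicot Require Export Coquelicot.
Open Scope R_scope.

(** * Calculus in the coordinate plane [C = R * R] *)

Inductive axis : Set := ax | ay.

Definition sum2 (f : axis -> R) : R := f ax + f ay.

Definition comp (a : axis) (p : C) : R :=
  match a with ax => fst p | ay => snd p end.

Definition ex_partial (a : axis) (f : C -> R) (p : C) : Prop :=
  match a with
  | ax => ex_derive (fun t => f (t, snd p)) (fst p)
  | ay => ex_derive (fun t => f (fst p, t)) (snd p)
  end.

Definition partial (a : axis) (f : C -> R) (p : C) : R :=
  match a with
  | ax => Derive (fun t => f (t, snd p)) (fst p)
  | ay => Derive (fun t => f (fst p, t)) (snd p)
  end.

(* All partial derivatives of order exactly [k] exist and are continuous on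
   [D]. Only used for open [D], where [forall k, Ck D k f] is C-infinity
   regularity. *)
Fixpoint Ck (D : C -> Prop) (k : nat) (f : C -> R) : Prop :=
  match k with
  | O => forall p, D p -> continuous f p
  | S k' => forall a, (forall p, D p -> ex_partial a f p) /\ Ck D k' (partial a f)
  end.

Definition smooth (f : C -> R) : Prop := forall k, Ck (fun _ => True) k f.

Definition smooth_near (f : C -> R) (p : C) : Prop :=
  exists r : posreal, forall k, Ck (fun q : C => ball p r q) k f.

(** * Riemannian metrics in coordinates *)

(* [g i j p] is the coefficient g_ij at [p]; only meaningful when the matrix
   is symmetric and positive definite. *)
Definition coord_metric : Type := axis -> axis -> C -> R.

Definition detg (g : coord_metric) (p : C) : R :=
  g ax ax p * g ay ay p - g ax ay p * g ay ax p.

(* inverse matrix g^ij *)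
Definition ginv (g : coord_metric) (i j : axis) (p : C) : R :=
  match i, j with
  | ax, ax => g ay ay p / detg g p
  | ay, ay => g ax ax p / detg g p
  | ax, ay => - g ax ay p / detg g p
  | ay, ax => - g ay ax p / detg g p
  end.

Definition inner (g : coord_metric) (p : C) (u v : axis -> R) : R :=
  sum2 (fun i => sum2 (fun j => g i j p * u i * v j)).

Definition grad (g : coord_metric) (f : C -> R) (p : C) (i : axis) : R :=
  sum2 (fun j => ginv g i j p * partial j f p).

Definition grad_norm_sq (g : coord_metric) (f : C -> R) (p : C) : R :=
  inner g p (grad g f p) (grad g f p).

Definition diverg (g : coord_metric) (X : C -> axis -> R) (p : C) : R :=
  sum2 (fun i => partial i (fun q => sqrt (detg g q) * X q i) p)
  / sqrt (detg g p).

Definition laplacian (g : coord_metric) (f : C -> R) : C -> R :=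
  diverg g (grad g f).

(* [christoffel g k i j]: nabla_i d_j = sum_k Gamma^k_ij d_k, for the
   Levi-Civita connection nabla *)
Definition christoffel (g : coord_metric) (k i j : axis) (p : C) : R :=
  / 2 * sum2 (fun l => ginv g k l p *
    (partial i (g j l) p + partial j (g i l) p - partial l (g i j) p)).

(* components of nabla_x nabla_y d_y - nabla_y nabla_x d_y *)
Definition riemann_xyy (g : coord_metric) (l : axis) (p : C) : R :=
  partial ax (christoffel g l ay ay) p - partial ay (christoffel g l ax ay) p
  + sum2 (fun m => christoffel g m ay ay p * christoffel g l ax m p
                 - christoffel g m ax ay p * christoffel g l ay m p).

(* sectional curvature <R(d_x, d_y) d_y, d_x> / det g, positive on round
   spheres *)
Definition gauss_curvature (g : coord_metric) (p : C) : R :=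
  sum2 (fun l => g l ax p * riemann_xyy g l p) / detg g p.

Definition generalized_ricci_coord (a b c : R) (g : coord_metric) : Prop :=
  let K := gauss_curvature g in
  forall p : C,
    (c - K p) * laplacian g K p + grad_norm_sq g K p
    + (a * K p + b) * (K p - c) ^ 2 = 0.

Definition pullback (f : C -> C) (h : coord_metric) : coord_metric :=
  fun i j p => sum2 (fun k => sum2 (fun l =>
    h k l (f p) * partial i (fun q => comp k (f q)) p
                * partial j (fun q => comp l (f q)) p)).

(** * The Riemann sphere *)

(* [None] is the point at infinity. *)
Definition sphere : Type := option C.

Definition sphere_inv (P : sphere) : sphere :=
  match P with
  | None => Some (RtoC 0)
  | Some z => if Ceq_dec z (RtoC 0) then None else Some (Cinv z)
  end.

(* the two affine charts, with coordinates z and w = 1/z *)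
Inductive chart : Set := chart_z | chart_w.

Definition dom (i : chart) (P : sphere) : Prop :=
  match i with
  | chart_z => P <> None
  | chart_w => P <> Some (RtoC 0)
  end.

(* inverse of the chart, a bijection from C onto [dom i] *)
Definition param (i : chart) (p : C) : sphere :=
  match i with
  | chart_z => Some p
  | chart_w => sphere_inv (Some p)
  end.

(* junk value 0 outside [dom i] *)
Definition coord (i : chart) (P : sphere) : C :=
  match (match i with chart_z => P | chart_w => sphere_inv P end) with
  | Some z => z
  | None => RtoC 0
  end.

(* coordinate expression of a map, relevant at [p] if
   [dom j (phi (param i p))] *)
Definition read_map (phi : sphere -> sphere) (i j : chart) (p : C) : C :=
  coord j (phi (param i p)).

Definition smooth_map (phi : sphere -> sphere) : Prop :=
  forall (i j : chart) (p : C), dom j (phi (param i p)) ->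
    locally p (fun q : C => dom j (phi (param i q))) /\
    forall a : axis, smooth_near (fun q => comp a (read_map phi i j q)) p.

(* phi^* h = g *)
Definition pulls_back (phi : sphere -> sphere) (h g : chart -> coord_metric)
  : Prop :=
  forall (i j : chart) (p : C), dom j (phi (param i p)) ->
    forall a b : axis, g i a b p = pullback (read_map phi i j) (h j) a b p.

(* [met_compat]: the expressions in the two charts define one tensor; for
   [phi = id] the maps [read_map phi i j] are the transition maps. *)
Record sphere_metric : Type := SphereMetric {
  met :> chart -> coord_metric;
  met_smooth : forall i a b, smooth (met i a b);
  met_sym : forall i a b p, met i a b p = met i b a p;
  met_pos : forall i p (v : axis -> R),
    (exists a, v a <> 0) -> 0 < inner (met i) p v v;
  met_compat : pulls_back (fun P => P) met met
}.

(* The Gaussian curvature does not depend on the coordinates; the chart w is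
   needed only at infinity. *)
Definition curvature (g : sphere_metric) (P : sphere) : R :=
  match P with
  | Some z => gauss_curvature (g chart_z) z
  | None => gauss_curvature (g chart_w) (RtoC 0)
  end.

Definition generalized_ricci (a b c : R) (g : sphere_metric) : Prop :=
  forall i : chart, generalized_ricci_coord a b c (g i).

Definition conformal (g : sphere_metric) : Prop :=
  forall (i : chart) (p : C), g i ax ax p = g i ay ay p /\ g i ax ay p = 0.

(* z |-> e^(i theta) z *)
Definition rotation (theta : R) (P : sphere) : sphere :=
  match P with
  | Some z => Some (Cmult (cos theta, sin theta) z)
  | None => None
  end.

Definition rotationally_invariant (g : sphere_metric) : Prop :=
  conformal g /\ forall theta : R, pulls_back (rotation theta) g g.

Definition isometric (g h : sphere_metric) : Prop :=
  exists phi psi : sphere -> sphere,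
    (forall P, psi (phi P) = P) /\ (forall P, phi (psi P) = P) /\
    smooth_map phi /\ smooth_map psi /\ pulls_back phi h g.

Definition has_sign {T : Type} (F : T -> R) (e : R) : Prop :=
  (e = 1 /\ (forall x, 0 <= F x) /\ exists x, F x <> 0) \/
  (e = -1 /\ (forall x, F x <= 0) /\ exists x, F x <> 0).

(* Main.v *)
From Stdlib Require Import Reals Lra Lia FunctionalExtensionality ClassicalEpsilon.
Require Import Defs.

(** Where [K <> c], the equation of type [(-2l, 0, c)] says that
    [Delta (log |K - c|) = - 2 l K]. For a conformal metric
    [E (dx^2 + dy^2)], the curvature is [K = - Delta (log E) / 2], so that
    the logarithm of [|K - c| / E^l] is harmonic. The simplest choice
    compatible with the symmetry between the poles is that [K - c] be a
    constant multiple [k (s E)^l], with [s = |z|^2]. With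
    [tau = log |z|] and [v = s E], this becomes the autonomous equation
    [(log v)'' = - 2 c v - 2 k v^(l+1)], which has a first integral
    [(v' / (2 v))^2 = 1 - c v - k v^(l+1) / (l+1)], the constant term 1 being
    imposed by smoothness at the poles. A solution that increases from 0 at one
    pole to the first root [v1] of the right-hand side, on the equator, and
    then decreases symmetrically to 0 gives a metric on the sphere.

    The solutions are indexed by [beta = k v1^(l+1) / (l+1)]; then
    [c v1 = 1 - beta]. Instead of [v], which has a critical point on the
    equator, the unknown is the latitude [x], with [v = v1 (1 - x^2)], which
    satisfies [dx/dtau = (1 - x^2) speed x] with a function [speed] that is
    equal to 1 at the poles. This equation is integrated by a quadrature:
    [radius_sq] gives [s] as a function of [x], it is invertible across [s = 0],
    and its inverse [latitude] provides the conformal factor as a function [dens]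
    of [s] (up to the constant [v1]). The metric is invariant under
    [z -> 1 / z], so that the same expression serves in the two charts. The curvature formula is
    [ldens_curvature], the equation is [factor_generalized_ricci], and
    smoothness ([factor_smooth]) follows from the fact that [latitude] solves a
    first order differential system with smooth coefficients.

    Two such metrics with different values of [beta] are not isometric: the
    extreme value of [K - c], attained on the equator, is
    [amplitude = (l+1) c beta / (1 - beta)], an injective function of [beta].
    The invariance of the curvature ([radial_curvature_isometry]) uses that an
    isometry between conformal metrics is holomorphic or antiholomorphic and
    that the logarithm of the modulus of its derivative is harmonic. *)

(** * Partial derivatives and a criterion for smoothness *)

Definition is_partial (a : axis) (f : C -> R) (p : C) (l : R) : Prop :=
  match a with
  | ax => is_derive (fun t => f (t, snd p)) (fst p) l
  | ay => is_derive (fun t => f (fst p, t)) (snd p) l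
  end.

Lemma is_partial_unique a f p l : is_partial a f p l -> partial a f p = l.
Proof. destruct a; exact (is_derive_unique _ _ _). Qed.

Lemma is_partial_ex a f p l : is_partial a f p l -> ex_partial a f p.
Proof. destruct a; intro H; exists l; exact H. Qed.

Lemma partial_correct a f p : ex_partial a f p -> is_partial a f p (partial a f p).
Proof. destruct a; exact (Derive_correct _ _). Qed.

Lemma is_partial_eq a f p l l' : is_partial a f p l -> l = l' -> is_partial a f p l'.
Proof. now intros H <-. Qed.

(** Iterated partial derivatives are computed by replacing the inner one by a
    closed formula as a function, which is what this extensional form allows. *)
Lemma partial_fun a f df :
  (forall p, is_partial a f p (df p)) -> partial a f = df.
Proof.
  intro H; apply functional_extensionality; intro p.
  now apply is_partial_unique.
Qed.

Lemma locally_section (a : axis) (p : C) (P : C -> Prop) :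
  locally p P ->
  match a with
  | ax => locally (fst p) (fun t => P (t, snd p))
  | ay => locally (snd p) (fun t => P (fst p, t))
  end.
Proof.
  intros [r Hr]; destruct a; exists r; intros t Ht; apply Hr;
    split; first [exact Ht | apply ball_center].
Qed.

Lemma is_partial_ext_loc a f g p l :
  locally p (fun q : C => f q = g q) -> is_partial a f p l -> is_partial a g p l.
Proof.
  intro H; pose proof (locally_section a p _ H) as Ha; revert Ha.
  destruct a; apply is_derive_ext_loc.
Qed.

Lemma is_partial_const a k p : is_partial a (fun _ => k) p 0.
Proof. destruct a; exact (is_derive_const (V := R_NormedModule) k _). Qed.

Definition kron (a b : axis) : R :=
  match a, b with ax, ax | ay, ay => 1 | _, _ => 0 end.

Lemma is_partial_comp_axis a b p : is_partial a (comp b) p (kron a b).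
Proof.
  destruct a, b; first [exact (is_derive_id _) | exact (is_derive_const (V := R_NormedModule) _ _)].
Qed.

Lemma is_partial_plus a f g p l m :
  is_partial a f p l -> is_partial a g p m ->
  is_partial a (fun q => f q + g q) p (l + m).
Proof. destruct a; apply @is_derive_plus. Qed.

Lemma is_partial_comp1 a (h : R -> R) f p l m :
  is_derive h (f p) m -> is_partial a f p l ->
  is_partial a (fun q => h (f q)) p (m * l).
Proof.
  destruct p as [x y].
  destruct a; intros Hh Hf; simpl in *; rewrite Rmult_comm;
   [apply (is_derive_comp h (fun t => f (t, y))) |
    apply (is_derive_comp h (fun t => f (x, t)))]; assumption.
Qed.

Lemma is_partial_mult a f g p l m :
  is_partial a f p l -> is_partial a g p m ->
  is_partial a (fun q => f q * g q) p (l * g p + f p * m).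
Proof.
  destruct p as [x y].
  destruct a; intros Hf Hg; simpl in *;
  [apply (is_derive_mult (fun t => f (t, y)) (fun t => g (t, y))) |
   apply (is_derive_mult (fun t => f (x, t)) (fun t => g (x, t)))];
   try assumption; apply Rmult_comm.
Qed.

Lemma is_partial_scal a k f p l :
  is_partial a f p l -> is_partial a (fun q => k * f q) p (k * l).
Proof.
  intro H; eapply is_partial_eq;
   [apply is_partial_mult; [apply is_partial_const | exact H] | simpl; ring].
Qed.

Lemma is_partial_opp a f p l :
  is_partial a f p l -> is_partial a (fun q => - f q) p (- l).
Proof. destruct a; apply @is_derive_opp. Qed.

Lemma is_derive_Rinv x : x <> 0 -> is_derive Rinv x (- / (x * x)).
Proof. intro H; auto_derive; [exact H | field; exact H]. Qed.

Lemma is_partial_inv a f p l :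
  f p <> 0 -> is_partial a f p l ->
  is_partial a (fun q => / f q) p (- / (f p * f p) * l).
Proof. intro H; apply (is_partial_comp1 a Rinv); now apply is_derive_Rinv. Qed.

Lemma is_partial_sqrt a f p l :
  0 < f p -> is_partial a f p l ->
  is_partial a (fun q => sqrt (f q)) p (/ 2 * / sqrt (f p) * l).
Proof.
  intro H; apply (is_partial_comp1 a sqrt).
  auto_derive; [exact H |]. field. apply Rgt_not_eq; now apply sqrt_lt_R0.
Qed.

Arguments is_partial : simpl never.

(** The functions obtained from those in [B], the constants and the two
    coordinates by the operations of calculus. The operations [inv] and [sqrt]
    are restricted to arguments where they are smooth. *)
Inductive generated (B : (C -> R) -> Prop) : (C -> R) -> Prop :=
| gen_base f : B f -> generated B f
| gen_const k : generated B (fun _ => k)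
| gen_coord a : generated B (comp a)
| gen_plus f g : generated B f -> generated B g -> generated B (fun q => f q + g q)
| gen_mult f g : generated B f -> generated B g -> generated B (fun q => f q * g q)
| gen_inv f : (forall q, f q <> 0) -> generated B f -> generated B (fun q => / f q)
| gen_sqrt f : (forall q, 0 < f q) -> generated B f -> generated B (fun q => sqrt (f q)).

(** The analogue for functions of a first order differential system: the
    partial derivatives of the generators are expressed by the generators
    themselves. *)
Definition derivation_closed (B : (C -> R) -> Prop) : Prop :=
  forall f, B f ->
    (forall p : C, continuous f p) /\
    forall a, exists df, generated B df /\ forall p, is_partial a f p (df p).

Lemma continuous_comp_axis a (p : C) : continuous (comp a) p.
Proof. destruct p as [x y], a; [apply (continuous_fst (U := R_UniformSpace) (V := R_UniformSpace)) | apply (continuous_snd (U := R_UniformSpace) (V := R_UniformSpace))]. Qed.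

Lemma continuous_Rinv_at x : x <> 0 -> continuous Rinv x.
Proof.
  intro H; apply (ex_derive_continuous Rinv); eexists; now apply is_derive_Rinv.
Qed.

Lemma generated_continuous B f :
  derivation_closed B -> generated B f -> forall p : C, continuous f p.
Proof.
  intros HB Hf; induction Hf as [f H|k|a|f g _ IHf _ IHg|f g _ IHf _ IHg|f H _ IHf|f H _ IHf]; intro p.
  - now apply HB.
  - apply continuous_const.
  - apply continuous_comp_axis.
  - now apply @continuous_plus.
  - now apply @continuous_mult.
  - apply (continuous_comp f Rinv); [apply IHf | now apply continuous_Rinv_at].
  - apply (continuous_comp f sqrt); [apply IHf | apply continuous_sqrt].
Qed.

Lemma generated_partial B f a :
  derivation_closed B -> generated B f ->
  exists df, generated B df /\ forall p, is_partial a f p (df p).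
Proof.
  intros HB Hf; induction Hf as [f H|k|b|f g Gf [f' [Gf' IHf]] Gg [g' [Gg' IHg]]
    |f g Gf [f' [Gf' IHf]] Gg [g' [Gg' IHg]]|f H Gf [f' [Gf' IHf]]|f H Gf [f' [Gf' IHf]]].
  - now apply HB.
  - exists (fun _ => 0); split; [apply gen_const | intro; apply is_partial_const].
  - exists (fun _ => kron a b); split; [apply gen_const | intro; apply is_partial_comp_axis].
  - exists (fun q => f' q + g' q); split; [now apply gen_plus | intro p; now apply is_partial_plus].
  - exists (fun q => f' q * g q + f q * g' q); split.
    + apply gen_plus; now apply gen_mult.
    + intro p; now apply is_partial_mult.
  - exists (fun q => (-1 * / (f q * f q)) * f' q); split.
    + apply gen_mult; [|exact Gf']. apply gen_mult; [apply gen_const|].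
      apply gen_inv; [|now apply gen_mult].
      intro q; now apply Rmult_integral_contrapositive.
    + intro p; eapply is_partial_eq; [now apply is_partial_inv | simpl; ring].
  - exists (fun q => (/ 2 * / sqrt (f q)) * f' q); split.
    + apply gen_mult; [|exact Gf']. apply gen_mult; [apply gen_const|].
      apply gen_inv; [|now apply gen_sqrt].
      intro q; apply Rgt_not_eq; now apply sqrt_lt_R0.
    + intro p; now apply is_partial_sqrt.
Qed.

(** Smoothness without computing any higher derivative: every function of the
    class is continuous, and the class is stable under partial derivatives. *)
Lemma generated_smooth B f :
  derivation_closed B -> generated B f -> smooth f.
Proof.
  intros HB Hf k; revert f Hf; induction k as [|k IH]; intros f Hf.
  - intros p _; now apply (generated_continuous B).
  - intro a; destruct (generated_partial B f a HB Hf) as [df [Gdf H]]; split.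
    + intros p _; eapply is_partial_ex; apply H.
    + rewrite (partial_fun a f df H); now apply IH.
Qed.

(** * Curvature, gradient and Laplacian of conformal metrics *)

Definition conf (E : C -> R) : coord_metric :=
  fun i j p => match i, j with ax, ax | ay, ay => E p | _, _ => 0 end.

Lemma detg_conf E p : detg (conf E) p = E p * E p.
Proof. unfold detg; simpl; ring. Qed.

Lemma ginv_conf E i j p : E p <> 0 -> ginv (conf E) i j p = kron i j * / E p.
Proof.
  intro H; unfold ginv; destruct i, j; rewrite detg_conf; simpl; field; exact H.
Qed.

Section Conformal.

Variables (E : C -> R) (E1 : axis -> C -> R).
Hypothesis (Epos : forall q, 0 < E q)
  (HE : forall a q, is_partial a E q (E1 a q)).

Let E_neq0 q : E q <> 0.
Proof. apply Rgt_not_eq, Epos. Qed.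

Lemma partial_conf a i j : partial a (conf E i j) = fun q => kron i j * E1 a q.
Proof.
  apply partial_fun; intro p; destruct i, j; simpl.
  - eapply is_partial_eq; [apply HE | ring].
  - eapply is_partial_eq; [apply is_partial_const | ring].
  - eapply is_partial_eq; [apply is_partial_const | ring].
  - eapply is_partial_eq; [apply HE | ring].
Qed.

Lemma christoffel_conf k i j :
  christoffel (conf E) k i j =
  fun q => (/ 2 * (kron j k * E1 i q + kron i k * E1 j q - kron i j * E1 k q)) * / E q.
Proof.
  apply functional_extensionality; intro q.
  unfold christoffel, sum2. rewrite !partial_conf, !ginv_conf by apply E_neq0.
  destruct i, j, k; simpl; field; apply E_neq0.
Qed.

(** This is [K = - Delta (log E) / (2 E)], with the flat Laplacian [Delta],
    the logarithm being expanded. *)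
Lemma gauss_curvature_conf (E2 : axis -> R) p :
  (forall a, is_partial a (E1 a) p (E2 a)) ->
  gauss_curvature (conf E) p =
  (E1 ax p ^ 2 + E1 ay p ^ 2 - E p * (E2 ax + E2 ay)) / (2 * E p ^ 3).
Proof.
  intro HE2.
  unfold gauss_curvature, sum2. simpl. unfold riemann_xyy, sum2.
  rewrite detg_conf, !christoffel_conf.
  erewrite (is_partial_unique ax _ p), (is_partial_unique ay _ p).
  2:{ apply is_partial_mult; [apply is_partial_scal | apply is_partial_inv; [apply E_neq0 | apply HE]].
      apply is_partial_ext_loc with (f := fun q => E1 ay q);
       [exists (mkposreal 1 Rlt_0_1); intros q _; simpl; ring | apply HE2]. }
  2:{ apply is_partial_mult; [apply is_partial_scal | apply is_partial_inv; [apply E_neq0 | apply HE]].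
      apply is_partial_ext_loc with (f := fun q => - E1 ax q);
       [exists (mkposreal 1 Rlt_0_1); intros q _; simpl; ring | apply is_partial_opp, HE2]. }
  simpl. field. apply E_neq0.
Qed.

Lemma grad_conf f f1 i :
  (forall a q, is_partial a f q (f1 a q)) ->
  forall q, grad (conf E) f q i = f1 i q * / E q.
Proof.
  intros Hf q; unfold grad, sum2; rewrite !ginv_conf by apply E_neq0.
  rewrite !(is_partial_unique _ f q _ (Hf _ q)); destruct i; simpl; ring.
Qed.

Lemma grad_norm_sq_conf f f1 p :
  (forall a q, is_partial a f q (f1 a q)) ->
  grad_norm_sq (conf E) f p = (f1 ax p ^ 2 + f1 ay p ^ 2) / E p.
Proof.
  intro Hf; unfold grad_norm_sq, inner, sum2.
  rewrite !(grad_conf f f1 _ Hf); simpl; field; apply E_neq0.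
Qed.

(** In dimension two the factor [sqrt (det g) = E] of the divergence cancels
    the factor [/ E] of the gradient. *)
Lemma laplacian_conf f f1 (f2 : axis -> R) p :
  (forall a q, is_partial a f q (f1 a q)) ->
  (forall a, is_partial a (f1 a) p (f2 a)) ->
  laplacian (conf E) f p = (f2 ax + f2 ay) / E p.
Proof.
  intros Hf Hf1; unfold laplacian, diverg, sum2.
  assert (Hs : forall q, sqrt (detg (conf E) q) = E q)
    by (intro q; rewrite detg_conf; apply sqrt_square; left; apply Epos).
  rewrite Hs.
  assert (Hd : forall a,
    (fun q => sqrt (detg (conf E) q) * grad (conf E) f q a) = f1 a).
  { intro a; apply functional_extensionality; intro q.
    rewrite Hs, (grad_conf f f1 _ Hf); field; apply E_neq0. }
  now rewrite !Hd, !(is_partial_unique _ _ p _ (Hf1 _)).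
Qed.

End Conformal.

Definition nsq (p : C) : R := fst p * fst p + snd p * snd p.

Lemma nsq_ge0 p : 0 <= nsq p.
Proof. unfold nsq; nra. Qed.

Lemma nsq_comp p : nsq p = comp ax p * comp ax p + comp ay p * comp ay p.
Proof. reflexivity. Qed.

Lemma is_partial_nsq a p : is_partial a nsq p (2 * comp a p).
Proof.
  eapply is_partial_eq.
  - apply (is_partial_plus a (fun q => comp ax q * comp ax q)
             (fun q => comp ay q * comp ay q));
      apply is_partial_mult; apply is_partial_comp_axis.
  - destruct a; simpl; ring.
Qed.

(** Two-sided derivatives are required at [s = 0] too, so that the chain rule
    applies to [fun q => f (nsq q)] at the origin of the plane. *)
Definition twice_derivable (f f1 f2 : R -> R) : Prop :=
  forall s, 0 <= s -> is_derive f s (f1 s) /\ is_derive f1 s (f2 s).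

Section Radial.

Variables (f f1 f2 : R -> R).
Hypothesis Hf : twice_derivable f f1 f2.

Lemma is_partial_radial a p :
  is_partial a (fun q => f (nsq q)) p (f1 (nsq p) * (2 * comp a p)).
Proof.
  apply is_partial_comp1; [apply Hf, nsq_ge0 | apply is_partial_nsq].
Qed.

Lemma is_partial_radial2 a p :
  is_partial a (fun q => f1 (nsq q) * (2 * comp a q)) p
    (4 * comp a p ^ 2 * f2 (nsq p) + 2 * f1 (nsq p)).
Proof.
  eapply is_partial_eq.
  - apply is_partial_mult.
    + apply is_partial_comp1; [apply Hf, nsq_ge0 | apply is_partial_nsq].
    + apply is_partial_scal, is_partial_comp_axis.
  - destruct a; simpl; ring.
Qed.

(** The curvature of [f (x^2 + y^2) (dx^2 + dy^2)], namely
    [- 2 (s f' / f)' / f]. *)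
Definition radial_curvature (s : R) : R :=
  2 * (s * f1 s ^ 2 - f s * f1 s - s * f s * f2 s) / f s ^ 3.

Hypothesis fpos : forall s, 0 <= s -> 0 < f s.

Lemma gauss_curvature_radial p :
  gauss_curvature (conf (fun q => f (nsq q))) p = radial_curvature (nsq p).
Proof.
  rewrite (gauss_curvature_conf _ (fun a q => f1 (nsq q) * (2 * comp a q)))
    with (E2 := fun a => 4 * comp a p ^ 2 * f2 (nsq p) + 2 * f1 (nsq p)).
  - unfold radial_curvature.
    pose proof (fpos (nsq p) (nsq_ge0 p)) as H.
    rewrite !(nsq_comp p) in *. field. apply Rgt_not_eq, H.
  - intro q; apply fpos, nsq_ge0.
  - intros; apply is_partial_radial.
  - intros; apply is_partial_radial2.
Qed.

End Radial.

Lemma generalized_ricci_radial f f1 f2 k k1 k2 a b c :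
  twice_derivable f f1 f2 -> (forall s, 0 <= s -> 0 < f s) ->
  twice_derivable k k1 k2 ->
  (forall s, 0 <= s -> radial_curvature f f1 f2 s = k s) ->
  (forall s, 0 <= s ->
    4 * ((c - k s) * (s * k2 s + k1 s) + s * k1 s ^ 2)
    + f s * (a * k s + b) * (k s - c) ^ 2 = 0) ->
  generalized_ricci_coord a b c (conf (fun q => f (nsq q))).
Proof.
  intros Hf fpos Hk Hcurv Heq; unfold generalized_ricci_coord.
  assert (HK : gauss_curvature (conf (fun q => f (nsq q))) = fun q => k (nsq q)).
  { apply functional_extensionality; intro q.
    rewrite (gauss_curvature_radial f f1 f2 Hf fpos). apply Hcurv, nsq_ge0. }
  rewrite HK; intro p.
  assert (Epos : forall q, 0 < f (nsq q)) by (intro; apply fpos, nsq_ge0).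
  rewrite (grad_norm_sq_conf _ Epos _ (fun i q => k1 (nsq q) * (2 * comp i q)))
    by (intros; now apply is_partial_radial with (f2 := k2)).
  rewrite (laplacian_conf _ Epos _ (fun i q => k1 (nsq q) * (2 * comp i q))
     (fun i => 4 * comp i p ^ 2 * k2 (nsq p) + 2 * k1 (nsq p))).
  2:{ intros; now apply is_partial_radial with (f2 := k2). }
  2:{ intros; now apply is_partial_radial2 with (f := k). }
  specialize (Heq (nsq p) (nsq_ge0 p)); specialize (Epos p).
  rewrite <- (Rmult_0_l (/ f (nsq p))), <- Heq.
  rewrite !(nsq_comp p) in *. field. now apply Rgt_not_eq.
Qed.

(** * Isometries preserve the curvature *)

Definition smooth_on (D : C -> Prop) (w : C -> R) : Prop := forall k, Ck D k w.

Lemma smooth_on_partial D w a : smooth_on D w -> smooth_on D (partial a w).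
Proof. intros H k; exact (proj2 (H (S k) a)). Qed.

Lemma smooth_on_is_partial D w a q :
  smooth_on D w -> D q -> is_partial a w q (partial a w q).
Proof. intros H Hq; apply partial_correct; exact (proj1 (H 1%nat a) q Hq). Qed.

Lemma smooth_on_continuous D w (q : C) : smooth_on D w -> D q -> continuous w q.
Proof. intros H Hq; exact (H 0%nat q Hq). Qed.

Lemma ball_C_open (p : C) r (q : C) : ball p r q -> locally q (fun z : C => ball p r z).
Proof.
  destruct p as [x y], q as [x' y']; intros [H1 H2]; simpl in H1, H2.
  change (Rabs (x' - x) < r) in H1; change (Rabs (y' - y) < r) in H2.
  set (d := Rmin (r - Rabs (x' - x)) (r - Rabs (y' - y))).
  assert (Hd : 0 < d) by (apply Rmin_pos; lra).
  pose proof (Rmin_l (r - Rabs (x' - x)) (r - Rabs (y' - y))) as Hl.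
  pose proof (Rmin_r (r - Rabs (x' - x)) (r - Rabs (y' - y))) as Hr.
  exists (mkposreal d Hd); intros [s t] [Hs Ht]; simpl in Hs, Ht.
  change (Rabs (s - x') < d) in Hs; change (Rabs (t - y') < d) in Ht.
  split; simpl; [change (Rabs (s - x) < r) | change (Rabs (t - y) < r)];
   [replace (s - x) with ((s - x') + (x' - x)) by ring
   |replace (t - y) with ((t - y') + (y' - y)) by ring];
   (eapply Rle_lt_trans; [apply Rabs_triang | unfold d in *; lra]).
Qed.

Lemma continuity_2d_of_continuous (w : C -> R) (q : C) :
  continuous w q -> continuity_2d_pt (fun x y => w (x, y)) (fst q) (snd q).
Proof.
  intro H; apply continuity_2d_pt_filterlim.
  destruct q as [x y]; simpl.
  apply filterlim_ext with (f := w); [now intros [s t] | exact H].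
Qed.

Lemma smooth_on_schwarz (p : C) r w (q : C) :
  smooth_on (fun z : C => ball p r z) w -> ball p r q ->
  partial ay (partial ax w) q = partial ax (partial ay w) q.
Proof.
  intros Hw Hq; symmetry.
  pose proof (smooth_on_partial _ _ ax Hw) as Hx.
  pose proof (smooth_on_partial _ _ ay Hw) as Hy.
  apply (Schwarz (fun x y => w (x, y)) (fst q) (snd q)).
  - apply locally_2d_locally; destruct q as [x y]; simpl.
    apply (filter_imp (fun z : C => ball p r z)); [|now apply ball_C_open].
    intros z Hz; repeat split.
    + exact (proj1 (Hw 1%nat ax) z Hz).
    + exact (proj1 (Hw 1%nat ay) z Hz).
    + exact (proj1 (Hy 1%nat ax) z Hz).
    + exact (proj1 (Hx 1%nat ay) z Hz).
  - apply (continuity_2d_of_continuous (partial ax (partial ay w))).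
    apply (smooth_on_continuous (fun z : C => ball p r z)); [|exact Hq]. now apply smooth_on_partial.
  - apply (continuity_2d_of_continuous (partial ay (partial ax w))).
    apply (smooth_on_continuous (fun z : C => ball p r z)); [|exact Hq]. now apply smooth_on_partial.
Qed.

(** With [sg = 1], [u + i v] is holomorphic; with [sg = -1], antiholomorphic. *)
Definition cauchy_riemann (sg : R) (D : C -> Prop) (u v : C -> R) : Prop :=
  forall q, D q -> partial ay u q = - sg * partial ax v q /\
                   partial ay v q = sg * partial ax u q.

(** The derivative of a holomorphic function is holomorphic: exchange the two
    partial derivatives by Schwarz's theorem and apply the equations for
    [u] and [v]. *)
Lemma cauchy_riemann_partial sg (p : C) r u v :
  smooth_on (fun z : C => ball p r z) u -> smooth_on (fun z : C => ball p r z) v ->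
  cauchy_riemann sg (fun z : C => ball p r z) u v ->
  cauchy_riemann sg (fun z : C => ball p r z) (partial ax u) (partial ax v).
Proof.
  intros Hu Hv H q Hq.
  rewrite !(smooth_on_schwarz p r) by assumption.
  split; apply is_partial_unique.
  - apply is_partial_ext_loc with (f := fun z => - sg * partial ax v z).
    + apply (filter_imp (fun z : C => ball p r z)); [|now apply ball_C_open].
      intros z Hz; symmetry; now apply H.
    + apply is_partial_scal, (smooth_on_is_partial (fun z : C => ball p r z)); [now apply smooth_on_partial | exact Hq].
  - apply is_partial_ext_loc with (f := fun z => sg * partial ax u z).
    + apply (filter_imp (fun z : C => ball p r z)); [|now apply ball_C_open].
      intros z Hz; symmetry; now apply H.
    + apply is_partial_scal, (smooth_on_is_partial (fun z : C => ball p r z)); [now apply smooth_on_partial | exact Hq].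
Qed.

(** A matrix with orthogonal columns of equal length is a similarity, direct or
    opposite: its determinant [d] satisfies [d^2 = L^2] by Lagrange's identity,
    and the sign of [d] decides. *)
Lemma conformal_matrix a b a' b' L :
  0 < L -> a * a + b * b = L -> a' * a' + b' * b' = L -> a * a' + b * b' = 0 ->
  (a * b' - b * a' = L /\ a' = - b /\ b' = a) \/
  (a * b' - b * a' = - L /\ a' = b /\ b' = - a).
Proof.
  intros HL H1 H2 H3.
  set (d := a * b' - b * a').
  assert (Hd : (d - L) * (d + L) = 0).
  { replace ((d - L) * (d + L)) with
      ((a * a + b * b) * (a' * a' + b' * b') - (a * a' + b * b') ^ 2 - L * L)
      by (unfold d; ring).
    rewrite H1, H2, H3; ring. }
  assert (Hsq : forall x y, x * x + y * y = 0 -> x = 0 /\ y = 0)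
    by (intros; split; nra).
  destruct (Rmult_integral _ _ Hd) as [E|E]; [left|right]; unfold d in *.
  - destruct (Hsq (a' + b) (b' - a)) as [e1 e2]; [nra | lra].
  - destruct (Hsq (a' - b) (b' + a)) as [e1 e2]; [nra | lra].
Qed.

Lemma smooth_on_weaken (D D' : C -> Prop) w :
  (forall q, D' q -> D q) -> smooth_on D w -> smooth_on D' w.
Proof.
  intros HD Hw k; specialize (Hw k); revert w Hw.
  induction k as [|k IH]; intros w Hw.
  - intros q Hq; apply Hw, HD, Hq.
  - intro a; destruct (Hw a) as [H1 H2]; split; [intros q Hq; apply H1, HD, Hq | now apply IH].
Qed.

Lemma pullback_conf phi F a b q :
  pullback phi (conf F) a b q =
  F (phi q) * (partial a (fun z => fst (phi z)) q * partial b (fun z => fst (phi z)) q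
             + partial a (fun z => snd (phi z)) q * partial b (fun z => snd (phi z)) q).
Proof.
  unfold pullback, sum2.
  change (fun q0 => comp ax (phi q0)) with (fun z => fst (phi z)).
  change (fun q0 => comp ay (phi q0)) with (fun z => snd (phi z)).
  unfold conf; ring.
Qed.

Section Isometry.

Variables (E F : C -> R) (phi : C -> C) (p : C).
Hypothesis (Fpos : forall q, 0 < F q) (Epos : forall q, 0 < E q).

Let u q := fst (phi q).
Let v q := snd (phi q).

Hypothesis (Hu : smooth_near u p) (Hv : smooth_near v p).
Hypothesis Hpull : locally p (fun q : C =>
  forall a b, conf E a b q = pullback phi (conf F) a b q).

Lemma pullback_conf_equations :
  locally p (fun q : C =>
    let ux := partial ax u q in let vx := partial ax v q in
    let uy := partial ay u q in let vy := partial ay v q in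
    E q = F (phi q) * (ux * ux + vx * vx) /\
    E q = F (phi q) * (uy * uy + vy * vy) /\
    ux * uy + vx * vy = 0).
Proof.
  revert Hpull; apply filter_imp; intros q Hq; cbv zeta.
  pose proof (Fpos (phi q)) as HF.
  pose proof (Hq ax ax) as Hxx; pose proof (Hq ay ay) as Hyy; pose proof (Hq ax ay) as Hxy.
  rewrite pullback_conf in Hxx, Hyy, Hxy.
  split; [exact Hxx | split; [exact Hyy |]].
  apply Rmult_eq_reg_l with (F (phi q)); [|lra].
  rewrite Rmult_0_r; symmetry; exact Hxy.
Qed.

(** An isometry between conformal metrics is holomorphic or antiholomorphic
    near each point. The sign is a priori chosen point by point; it is locally
    constant because it is the sign of the Jacobian, which is continuous and
    does not vanish. *)
Lemma isometry_cauchy_riemann :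
  exists (r : posreal) (sg : R), sg * sg = 1 /\
    smooth_on (fun z : C => ball p r z) u /\ smooth_on (fun z : C => ball p r z) v /\
    cauchy_riemann sg (fun z : C => ball p r z) u v /\
    forall q : C, ball p r q ->
      E q = F (phi q) * (partial ax u q * partial ax u q + partial ax v q * partial ax v q).
Proof.
  destruct Hu as [r1 H1], Hv as [r2 H2].
  pose proof pullback_conf_equations as Heq.
  assert (Hdet : continuous (fun q => partial ax u q * partial ay v q
                                      - partial ax v q * partial ay u q) p).
  { apply @continuous_minus; apply @continuous_mult;
      [apply (H1 1%nat ax) | apply (H2 1%nat ay) | apply (H2 1%nat ax) | apply (H1 1%nat ay)];
      apply ball_center. }
  set (det := fun q => partial ax u q * partial ay v q - partial ax v q * partial ay u q) in Hdet.
  assert (Hdich : forall q, E q = F (phi q) * (partial ax u q * partial ax u q + partial ax v q * partial ax v q) ->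
     E q = F (phi q) * (partial ay u q * partial ay u q + partial ay v q * partial ay v q) ->
     partial ax u q * partial ay u q + partial ax v q * partial ay v q = 0 ->
     (0 < det q /\ partial ay u q = - partial ax v q /\ partial ay v q = partial ax u q) \/
     (det q < 0 /\ partial ay u q = partial ax v q /\ partial ay v q = - partial ax u q)).
  { intros q e1 e2 e3.
    assert (HL : 0 < E q / F (phi q)) by (apply Rdiv_lt_0_compat; auto).
    pose proof (Fpos (phi q)) as HF.
    destruct (conformal_matrix (partial ax u q) (partial ax v q) (partial ay u q) (partial ay v q)
       (E q / F (phi q)) HL) as [[d [e4 e5]]|[d [e4 e5]]].
    - rewrite e1; field; lra.
    - rewrite e2; field; lra.
    - exact e3.
    - left; unfold det; repeat split; lra.
    - right; unfold det; repeat split; lra. }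
  assert (Hsign : exists sg, sg * sg = 1 /\
     locally p (fun q : C => partial ay u q = - sg * partial ax v q /\ partial ay v q = sg * partial ax u q)).
  { destruct (locally_singleton _ _ Heq) as [e1 [e2 e3]].
    destruct (Hdich p e1 e2 e3) as [[Hp _]|[Hp _]].
    - exists 1; split; [ring|].
      assert (Hl : locally p (fun q : C => 0 < det q))
        by (apply (Hdet (fun y => 0 < y)), (open_gt 0), Hp).
      generalize (filter_and _ _ Hl Heq); apply filter_imp; intros q [Hq [f1 [f2 f3]]].
      destruct (Hdich q f1 f2 f3) as [[_ [g1 g2]]|[Hn _]]; [split; lra | lra].
    - exists (-1); split; [ring|].
      assert (Hl : locally p (fun q : C => det q < 0))
        by (apply (Hdet (fun y => y < 0)), (open_lt 0), Hp).
      generalize (filter_and _ _ Hl Heq); apply filter_imp; intros q [Hq [f1 [f2 f3]]].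
      destruct (Hdich q f1 f2 f3) as [[Hn _]|[_ [g1 g2]]]; [lra | split; lra]. }
  destruct Hsign as [sg [Hsg Hcr]].
  destruct (filter_and _ _ Hcr Heq) as [r3 H3].
  assert (Hr : 0 < Rmin r3 (Rmin r1 r2)) by (repeat apply Rmin_pos; apply cond_pos).
  pose proof (Rmin_l r3 (Rmin r1 r2)) as L3.
  pose proof (Rle_trans _ _ _ (Rmin_r r3 (Rmin r1 r2)) (Rmin_l r1 r2)) as L1.
  pose proof (Rle_trans _ _ _ (Rmin_r r3 (Rmin r1 r2)) (Rmin_r r1 r2)) as L2.
  exists (mkposreal _ Hr), sg; simpl.
  split; [exact Hsg|]; split; [|split; [|split]].
  - apply (smooth_on_weaken (fun z : C => ball p r1 z)); [|exact H1].
    intros q; now apply ball_le.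
  - apply (smooth_on_weaken (fun z : C => ball p r2 z)); [|exact H2].
    intros q; now apply ball_le.
  - intros q Hq; exact (proj1 (H3 q (ball_le _ _ _ L3 _ Hq))).
  - intros q Hq; exact (proj1 (proj2 (H3 q (ball_le _ _ _ L3 _ Hq)))).
Qed.

End Isometry.

(** The curvature is invariant under isometries. If [phi] is the isometry, seen
    as a holomorphic function up to conjugation, then
    [E = |phi'|^2 (F o phi)]; since [log |phi'|^2] is harmonic, only [F]
    contributes to the Laplacian of [log E]. As [F] is a function of
    [N = |phi|^2] alone, the chain rule is needed in one variable only. *)
Lemma radial_curvature_isometry f f1 f2 h h1 h2 (phi : C -> C) (p : C) :
  twice_derivable f f1 f2 -> (forall s, 0 <= s -> 0 < f s) ->
  twice_derivable h h1 h2 -> (forall s, 0 <= s -> 0 < h s) ->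
  (forall a, smooth_near (fun q => comp a (phi q)) p) ->
  locally p (fun q : C => forall a b,
     conf (fun z => f (nsq z)) a b q = pullback phi (conf (fun z => h (nsq z))) a b q) ->
  radial_curvature f f1 f2 (nsq p) = radial_curvature h h1 h2 (nsq (phi p)).
Proof.
  intros Hf fpos Hh hpos Hphi Hpull.
  rewrite <- (gauss_curvature_radial f f1 f2 Hf fpos).
  set (E := fun z => f (nsq z)) in *.
  assert (Epos : forall q, 0 < E q) by (intro; apply fpos, nsq_ge0).
  destruct (isometry_cauchy_riemann E (fun z => h (nsq z)) phi p
     (fun q => hpos _ (nsq_ge0 q)) Epos (Hphi ax) (Hphi ay) Hpull)
    as [r [sg [Hsg [Hu [Hv [CR0 HE]]]]]].
  set (u := fun q => fst (phi q)) in *. set (v := fun q => snd (phi q)) in *.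
  set (D := fun z : C => ball p r z) in *.
  assert (sg1 : sg = 1 \/ sg = -1)
    by (destruct (Rmult_integral (sg - 1) (sg + 1)); [nra | left; lra | right; lra]).
  pose proof (cauchy_riemann_partial _ _ _ _ _ Hu Hv CR0) as CR1.
  pose proof (smooth_on_partial _ _ ax Hu) as Hux.
  pose proof (smooth_on_partial _ _ ax Hv) as Hvx.
  pose proof (cauchy_riemann_partial _ _ _ _ _ Hux Hvx CR1) as CR2.
  pose proof (smooth_on_partial _ _ ax Hux) as Huxx.
  pose proof (smooth_on_partial _ _ ax Hvx) as Hvxx.
  unfold cauchy_riemann in CR0, CR1, CR2.
  set (ux := partial ax u) in *. set (vx := partial ax v) in *.
  set (uxx := partial ax ux) in *. set (vxx := partial ax vx) in *.
  set (uxxx := partial ax uxx) in *. set (vxxx := partial ax vxx) in *.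
  (* By the Cauchy-Riemann equations, the derivative of a pair in the direction
     [a] is determined by its derivative [(x, y)] in the direction [ax]. *)
  set (du := fun a x y => match a with ax => x | ay => - sg * y end : R).
  set (dv := fun a x y => match a with ax => y | ay => sg * x end : R).
  assert (P0 : forall a q, D q -> is_partial a u q (du a (ux q) (vx q)) /\
                                  is_partial a v q (dv a (ux q) (vx q))).
  { intros a q Hq; destruct (CR0 q Hq) as [e1 e2].
    destruct a; simpl; rewrite <- ?e1, <- ?e2; split; now apply (smooth_on_is_partial D). }
  assert (P1 : forall a q, D q -> is_partial a ux q (du a (uxx q) (vxx q)) /\
                                  is_partial a vx q (dv a (uxx q) (vxx q))).
  { intros a q Hq; destruct (CR1 q Hq) as [e1 e2].
    destruct a; simpl; rewrite <- ?e1, <- ?e2; split; now apply (smooth_on_is_partial D). }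
  assert (P2 : forall a q, D q -> is_partial a uxx q (du a (uxxx q) (vxxx q)) /\
                                  is_partial a vxx q (dv a (uxxx q) (vxxx q))).
  { intros a q Hq; destruct (CR2 q Hq) as [e1 e2].
    destruct a; simpl; rewrite <- ?e1, <- ?e2; split; now apply (smooth_on_is_partial D). }
  assert (Dp : D p) by apply ball_center.
  set (N := fun q => u q * u q + v q * v q).
  set (lam := fun q => ux q * ux q + vx q * vx q).
  set (N1 := fun a q => 2 * (u q * du a (ux q) (vx q) + v q * dv a (ux q) (vx q))).
  set (lam1 := fun a q => 2 * (ux q * du a (uxx q) (vxx q) + vx q * dv a (uxx q) (vxx q))).
  assert (HN : forall a q, D q -> is_partial a N q (N1 a q)).
  { intros a q Hq; destruct (P0 a q Hq) as [e1 e2]; eapply is_partial_eq.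
    - apply is_partial_plus; apply is_partial_mult; eassumption.
    - unfold N1; ring. }
  assert (Hlam : forall a q, D q -> is_partial a lam q (lam1 a q)).
  { intros a q Hq; destruct (P1 a q Hq) as [e1 e2]; eapply is_partial_eq.
    - apply is_partial_plus; apply is_partial_mult; eassumption.
    - unfold lam1; ring. }
  set (E1 := fun a q => lam1 a q * h (N q) + lam q * (h1 (N q) * N1 a q)).
  assert (HE1 : forall a q, D q -> f1 (nsq q) * (2 * comp a q) = E1 a q).
  { intros a q Hq.
    rewrite <- (is_partial_unique a E q _ (is_partial_radial f f1 f2 Hf a q)).
    apply is_partial_unique.
    apply is_partial_ext_loc with (f := fun z => lam z * h (N z)).
    - apply (filter_imp D); [|now apply ball_C_open].
      intros z Hz; rewrite (HE z Hz); unfold N, lam; apply Rmult_comm.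
    - apply is_partial_mult; [now apply Hlam|].
      apply is_partial_comp1; [apply Hh, (nsq_ge0 (phi q)) | now apply HN]. }
  (* The terms with opposite signs for the two directions express that the real
     and imaginary parts of [phi] and of [phi'] are harmonic. *)
  set (N2 := fun a => 2 * (du a (ux p) (vx p) ^ 2 + dv a (ux p) (vx p) ^ 2
       + match a with ax => u p * uxx p + v p * vxx p | ay => - (u p * uxx p + v p * vxx p) end)).
  set (lam2 := fun a => 2 * (du a (uxx p) (vxx p) ^ 2 + dv a (uxx p) (vxx p) ^ 2
       + match a with ax => ux p * uxxx p + vx p * vxxx p | ay => - (ux p * uxxx p + vx p * vxxx p) end)).
  assert (HN1 : forall a, is_partial a (N1 a) p (N2 a)).
  { intro a; destruct (P0 a p Dp) as [e1 e2], (P1 a p Dp) as [e3 e4].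
    destruct a; simpl in e1, e2, e3, e4; unfold N1, N2; simpl; eapply is_partial_eq.
    - apply is_partial_scal, is_partial_plus; apply is_partial_mult; eassumption.
    - ring.
    - apply is_partial_scal, is_partial_plus; apply is_partial_mult;
        [eassumption | apply is_partial_scal; eassumption
        |eassumption | apply is_partial_scal; eassumption].
    - destruct sg1 as [-> | ->]; ring. }
  assert (Hlam1 : forall a, is_partial a (lam1 a) p (lam2 a)).
  { intro a; destruct (P1 a p Dp) as [e1 e2], (P2 a p Dp) as [e3 e4].
    destruct a; simpl in e1, e2, e3, e4; unfold lam1, lam2; simpl; eapply is_partial_eq.
    - apply is_partial_scal, is_partial_plus; apply is_partial_mult; eassumption.
    - ring.
    - apply is_partial_scal, is_partial_plus; apply is_partial_mult;
        [eassumption | apply is_partial_scal; eassumption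
        |eassumption | apply is_partial_scal; eassumption].
    - destruct sg1 as [-> | ->]; ring. }
  rewrite (gauss_curvature_conf E (fun a q => f1 (nsq q) * (2 * comp a q)) Epos
      (fun a q => is_partial_radial f f1 f2 Hf a q)
      (fun a => lam2 a * h (N p) + 2 * (lam1 a p * (h1 (N p) * N1 a p))
         + lam p * (h2 (N p) * N1 a p * N1 a p + h1 (N p) * N2 a))).
  2:{ intro a; apply is_partial_ext_loc with (f := E1 a).
      - apply (filter_imp D); [|now apply ball_C_open].
        intros z Hz; symmetry; now apply HE1.
      - unfold E1; eapply is_partial_eq.
        + apply is_partial_plus; apply is_partial_mult;
            [apply Hlam1
            |apply (is_partial_comp1 a h); [apply Hh, (nsq_ge0 (phi p)) | apply HN, Dp]
            |apply Hlam, Dp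
            |apply is_partial_mult; [apply (is_partial_comp1 a h1); [apply Hh, (nsq_ge0 (phi p)) | apply HN, Dp] | apply HN1]].
        + cbv beta; ring. }
  rewrite !HE1 by exact Dp.
  replace (E p) with (lam p * h (N p)) by (rewrite (HE p Dp); unfold N, lam; apply Rmult_comm).
  assert (hp : 0 < h (N p)) by apply hpos, (nsq_ge0 (phi p)).
  assert (lp : lam p <> 0).
  { intro Z; specialize (Epos p); rewrite (HE p Dp) in Epos; fold (lam p) in Epos.
    rewrite Z in Epos; lra. }
  unfold radial_curvature. change (nsq (phi p)) with (N p).
  unfold E1, lam1, N1, lam2, N2, du, dv.
  assert (HNp : N p = u p * u p + v p * v p) by reflexivity.
  assert (Hlp : lam p = ux p * ux p + vx p * vx p) by reflexivity.
  revert lp HNp Hlp hp.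
  generalize (h (N p)) (h1 (N p)) (h2 (N p)) (N p) (lam p) (u p) (v p) (ux p) (vx p) (uxx p) (vxx p) (uxxx p) (vxxx p).
  intros h0 h1' h2' n L a b a1 b1 a2 b2 a3 b3 lp Hn HL hp.
  match goal with |- ?num / _ = 2 * ?k / _ =>
    assert (Hnum : num = 4 * L ^ 3 * k) end.
  { subst n L. destruct sg1 as [-> | ->]; ring. }
  rewrite Hnum; field; split; lra.
Qed.

(** * The profile of the metrics *)

(** Monotonicity gives the continuity of [g]; then the first order expansion of
    [f] at [g s0] is solved for [g s - g s0]. *)
Lemma is_derive_inverse (f df g : R -> R) (a b s0 : R) :
  (forall x, a < x < b -> is_derive f x (df x)) ->
  (forall x, a < x < b -> 0 < df x) ->
  locally s0 (fun s => a < g s < b /\ f (g s) = s) ->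
  is_derive g s0 (/ df (g s0)).
Proof.
  intros Hf Hdf Hg.
  destruct (locally_singleton _ _ Hg) as [H0 E0].
  assert (Hincr : forall x y, a < x -> x < y -> y < b -> f x < f y).
  { intros x y Hx Hxy Hy; apply (incr_function f a b df); simpl; auto; intros; apply Hdf; auto. }
  set (x0 := g s0) in *.
  (* [g s] lies between any two points whose images by [f] enclose [s]. *)
  assert (Hcont : continuous g s0).
  { intros P [e He].
    set (x1 := Rmax ((a + x0) / 2) (x0 - e / 2)).
    set (x2 := Rmin ((x0 + b) / 2) (x0 + e / 2)).
    pose proof (cond_pos e) as ep.
    assert (B1 : a < x1 /\ x1 < x0 /\ x0 - e < x1).
    { unfold x1; split; [|split].
      - eapply Rlt_le_trans; [|apply Rmax_l]; lra.
      - apply Rmax_lub_lt; lra.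
      - eapply Rlt_le_trans; [|apply Rmax_r]; lra. }
    assert (B2 : x2 < b /\ x0 < x2 /\ x2 < x0 + e).
    { unfold x2; split; [|split].
      - eapply Rle_lt_trans; [apply Rmin_l|]; lra.
      - apply Rmin_glb_lt; lra.
      - eapply Rle_lt_trans; [apply Rmin_r|]; lra. }
    destruct B1 as [B11 [B12 B13]], B2 as [B21 [B22 B23]].
    assert (F1 : f x1 < s0) by (rewrite <- E0; apply Hincr; lra).
    assert (F2 : s0 < f x2) by (rewrite <- E0; apply Hincr; lra).
    unfold filtermap.
    generalize (filter_and _ _ Hg (filter_and _ _ (open_gt _ _ F1) (open_lt _ _ F2))).
    apply filter_imp; intros s [[Hs Es] [G1 G2]].
    apply He; change (Rabs (g s - x0) < e); apply Rabs_def1.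
    - destruct (Rlt_dec (g s) x2) as [L|L]; [lra|exfalso].
      destruct (Req_dec (g s) x2) as [Q|Q]; [rewrite Q in Es; lra|].
      pose proof (Hincr x2 (g s) ltac:(lra) ltac:(lra) ltac:(lra)); lra.
    - destruct (Rlt_dec x1 (g s)) as [L|L]; [lra|exfalso].
      destruct (Req_dec (g s) x1) as [Q|Q]; [rewrite Q in Es; lra|].
      pose proof (Hincr (g s) x1 ltac:(lra) ltac:(lra) ltac:(lra)); lra. }
  split; [apply is_linear_scal_l|].
  intros y Hy; rewrite <- (is_filter_lim_locally_unique _ _ Hy); clear y Hy.
  intro eps; set (d := df x0). assert (dpos : 0 < d) by now apply Hdf.
  pose proof (cond_pos eps) as ep.
  (* The bound [d / 2] gives [|g s - x0| <= 2 |s - s0| / d], and the second one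
     turns the remaining error into [eps |s - s0|]. *)
  assert (edd : 0 < eps * d * d) by (repeat apply Rmult_lt_0_compat; assumption).
  assert (He' : 0 < Rmin (d / 2) (eps * d * d / 2)) by (apply Rmin_pos; lra).
  set (e' := mkposreal _ He').
  pose proof (Rmin_l (d / 2) (eps * d * d / 2)) as L1.
  pose proof (Rmin_r (d / 2) (eps * d * d / 2)) as L2.
  destruct (Hf x0 H0) as [_ Hd].
  specialize (Hd x0 (fun P HP => HP) e').
  generalize (filter_and _ _ Hg (Hcont _ Hd)); apply filter_imp; intros s [[_ Es] Hs].
  fold x0 in Hs |- *.
  change (Rabs (f (g s) - f x0 - (g s - x0) * d) <= e' * Rabs (g s - x0)) in Hs.
  change (Rabs (g s - x0 - (s - s0) * / d) <= eps * Rabs (s - s0)).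
  rewrite Es, E0 in Hs. change (pos e') with (Rmin (d / 2) (eps * d * d / 2)) in Hs.
  set (x := g s) in *.
  pose proof (Rabs_pos (x - x0)) as Px.
  assert (Hbig : d / 2 * Rabs (x - x0) <= Rabs (s - s0)).
  { pose proof (Rabs_triang (s - s0) (- (s - s0 - (x - x0) * d))) as T.
    rewrite Rabs_Ropp in T.
    replace (s - s0 + - (s - s0 - (x - x0) * d)) with ((x - x0) * d) in T by ring.
    rewrite Rabs_mult, (Rabs_pos_eq d) in T by lra.
    assert (Rmin (d / 2) (eps * d * d / 2) * Rabs (x - x0) <= d / 2 * Rabs (x - x0))
      by (apply Rmult_le_compat_r; lra).
    lra. }
  replace (x - x0 - (s - s0) * / d) with (- / d * (s - s0 - (x - x0) * d)) by (field; lra).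
  rewrite Rabs_mult, Rabs_Ropp, Rabs_pos_eq by (left; now apply Rinv_0_lt_compat).
  apply Rmult_le_reg_l with d; [exact dpos|].
  rewrite <- Rmult_assoc, Rinv_r, Rmult_1_l by lra.
  eapply Rle_trans; [exact Hs|].
  apply Rle_trans with (eps * d * d / 2 * Rabs (x - x0)); [apply Rmult_le_compat_r; lra|].
  nra.
Qed.

Fixpoint geom (n : nat) (t : R) : R :=
  match n with O => 0 | S m => 1 + t * geom m t end.

Fixpoint dgeom (n : nat) (t : R) : R :=
  match n with O => 0 | S m => geom m t + t * dgeom m t end.

Lemma is_derive_geom n t : is_derive (geom n) t (dgeom n t).
Proof.
  induction n as [|n IH]; simpl.
  - exact (is_derive_const (V := R_NormedModule) 0 t).
  - auto_derive; [repeat split; eexists; exact IH|].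
    replace (Derive (fun x => geom n x) t) with (dgeom n t) by (symmetry; now apply is_derive_unique).
    ring.
Qed.

Lemma geom_sum n t : (1 - t) * geom n t = 1 - t ^ n.
Proof.
  induction n as [|n IH]; simpl; [ring|].
  replace ((1 - t) * (1 + t * geom n t)) with (1 - t + t * ((1 - t) * geom n t)) by ring.
  rewrite IH; ring.
Qed.

Lemma dgeom_sum n t : t * ((1 - t) * dgeom n t - geom n t) = - INR n * t ^ n.
Proof.
  induction n as [|n IH]; [simpl; ring|].
  rewrite S_INR; simpl.
  replace (t * ((1 - t) * (geom n t + t * dgeom n t) - (1 + t * geom n t)))
    with (t * ((1 - t) * geom n t) + t * (t * ((1 - t) * dgeom n t - geom n t)) - t) by ring.
  rewrite IH, geom_sum; ring.
Qed.

Lemma geom_bounds n t : 0 <= t <= 1 -> 0 <= geom n t <= INR n.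
Proof.
  intro H; induction n as [|n IH]; [simpl; lra|].
  rewrite S_INR; simpl; nra.
Qed.

Section Profile.

Variables (l : nat) (beta : R).
Hypothesis hbeta : 0 < 1 + beta * INR l.

(** With [t = 1 - x^2], where [x] is the latitude, [(1 - t) speed_sq t] is the
    polynomial [(1 - beta) (1 - t) + beta (1 - t^(l+1))] of the first integral
    [(v'/(2v))^2 = 1 - (1 - beta) t - beta t^(l+1)], divided by its
    root [t = 1]. *)
Definition speed_sq (t : R) : R := 1 + beta * (t * geom l t).
Definition dspeed_sq (t : R) : R := beta * (geom l t + t * dgeom l t).

(** A positive value below [speed_sq] on the interval [0 <= t <= 1], at which
    [speed_sq] is cut off outside of it. *)
Definition floor_val : R := Rmin 1 (1 + beta * INR l) / 2.

Lemma floor_pos : 0 < floor_val.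
Proof. unfold floor_val; assert (0 < Rmin 1 (1 + beta * INR l)) by (apply Rmin_pos; lra); lra. Qed.

Lemma speed_sq_floor t : 0 <= t <= 1 -> floor_val < speed_sq t.
Proof.
  intro H; pose proof (geom_bounds l t H) as G.
  assert (Hl : 0 <= INR l) by apply pos_INR.
  assert (T : 0 <= t * geom l t <= INR l) by nra.
  pose proof floor_pos as F; unfold floor_val in *; unfold speed_sq.
  pose proof (Rmin_l 1 (1 + beta * INR l)); pose proof (Rmin_r 1 (1 + beta * INR l)).
  destruct (Rle_dec 0 beta); nra.
Qed.

Lemma speed_sq_pos t : 0 <= t <= 1 -> 0 < speed_sq t.
Proof. intro H; pose proof (speed_sq_floor t H); pose proof floor_pos; lra. Qed.

Lemma is_derive_speed_sq t : is_derive speed_sq t (dspeed_sq t).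
Proof.
  unfold speed_sq, dspeed_sq; pose proof (is_derive_geom l t) as G; auto_derive.
  - repeat split; eexists; exact G.
  - replace (Derive (fun x => geom l x) t) with (dgeom l t) by (symmetry; now apply is_derive_unique). ring.
Qed.

(** The latitude [x] satisfies [dx/dtau = (1 - x^2) speed x] with
    [s = exp (2 tau)]. The clipped version is continuous and positive on the
    whole line, so that it can be integrated across [x = -1], the value of the
    latitude at the origin. *)
Definition speed (x : R) : R := sqrt (speed_sq (1 - x * x)).
Definition speed_clip (x : R) : R := sqrt (Rmax (speed_sq (1 - x * x)) floor_val).

(** This is [2 (1 / speed x - 1) / (1 - x^2)] with the singularities at
    [x = -1] and [x = 1] removed: [1 - (speed x)^2] has the factor
    [1 - x^2]. *)
Definition slope (x : R) : R := - 2 * beta * geom l (1 - x * x) * / (speed x * (1 + speed x)).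
Definition slope_clip (x : R) : R := - 2 * beta * geom l (1 - x * x) * / (speed_clip x * (1 + speed_clip x)).

Lemma tau_range x : -1 <= x <= 1 -> 0 <= 1 - x * x <= 1.
Proof. intro; nra. Qed.

Lemma speed_clip_pos x : 0 < speed_clip x.
Proof.
  apply sqrt_lt_R0. eapply Rlt_le_trans; [apply floor_pos | apply Rmax_r].
Qed.

Lemma speed_clip_speed x : -1 <= x <= 1 -> speed_clip x = speed x.
Proof.
  intro H; unfold speed_clip, speed; rewrite Rmax_left; [easy|].
  left; now apply speed_sq_floor, tau_range.
Qed.

Lemma speed_pos x : -1 <= x <= 1 -> 0 < speed x.
Proof. intro H; rewrite <- speed_clip_speed by exact H; apply speed_clip_pos. Qed.

Lemma slope_clip_slope x : -1 <= x <= 1 -> slope_clip x = slope x.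
Proof. intro H; unfold slope_clip, slope; now rewrite speed_clip_speed. Qed.

Lemma continuous_Rmax_r k y : continuous (fun z => Rmax z k) y.
Proof.
  apply continuous_ext with (fun z => (z + k + Rabs (z - k)) * / 2).
  - intro z; unfold Rmax; destruct (Rle_dec z k);
      [rewrite Rabs_left1 by lra | rewrite Rabs_pos_eq by lra]; match goal with |- @eq _ ?a ?b => change (@eq R a b) end; field.
  - apply (continuous_mult (K := R_AbsRing)); [|apply continuous_const].
    apply (continuous_plus (V := R_NormedModule)); [apply (continuous_plus (V := R_NormedModule)); [apply continuous_id | apply continuous_const]|].
    apply (continuous_comp (fun z => z - k) Rabs); [|apply continuous_Rabs].
    apply (continuous_minus (V := R_NormedModule)); [apply continuous_id | apply continuous_const].
Qed.

Lemma continuous_tau x : continuous (fun y => 1 - y * y) x.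
Proof. apply (ex_derive_continuous (fun y => 1 - y * y)); auto_derive; exact I. Qed.

Lemma continuous_speed_clip x : continuous speed_clip x.
Proof.
  apply continuous_sqrt_comp.
  apply (continuous_comp (fun y => speed_sq (1 - y * y)) (fun z => Rmax z floor_val));
    [|apply continuous_Rmax_r].
  apply (continuous_comp (fun y => 1 - y * y) speed_sq); [apply continuous_tau|].
  apply (ex_derive_continuous speed_sq); eexists; apply is_derive_speed_sq.
Qed.

Lemma continuous_slope_clip x : continuous slope_clip x.
Proof.
  pose proof (speed_clip_pos x) as P.
  apply (continuous_mult (K := R_AbsRing)).
  - apply (continuous_mult (K := R_AbsRing)); [apply continuous_const|].
    apply (continuous_comp (fun y => 1 - y * y) (geom l)); [apply continuous_tau|].
    apply (ex_derive_continuous (geom l)); eexists; apply is_derive_geom.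
  - apply (continuous_comp (fun y => speed_clip y * (1 + speed_clip y)) Rinv).
    + apply (continuous_mult (K := R_AbsRing)); [apply continuous_speed_clip|].
      apply (continuous_plus (V := R_NormedModule)); [apply continuous_const | apply continuous_speed_clip].
    + apply continuous_Rinv_at; nra.
Qed.

Definition expo (x : R) : R := RInt slope_clip 0 x.

Lemma is_derive_expo x : is_derive expo x (slope_clip x).
Proof.
  apply is_derive_RInt with (a := 0); [|apply continuous_slope_clip].
  exists (mkposreal 1 Rlt_0_1); intros y _; apply (RInt_correct slope_clip).
  apply (ex_RInt_continuous slope_clip); intros; apply continuous_slope_clip.
Qed.

Lemma expo_0 : expo 0 = 0.
Proof. apply (RInt_point (V := R_CompleteNormedModule)). Qed.

Lemma expo_odd x : expo (- x) = - expo x.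
Proof.
  assert (He : forall y, slope_clip (- y) = slope_clip y).
  { intro y; unfold slope_clip, speed_clip; now replace (- y * - y) with (y * y) by ring. }
  unfold expo.
  assert (H : RInt (fun y => scal (-1) (slope_clip (- y))) 0 x = RInt slope_clip (- 0) (- x)).
  { apply (RInt_comp slope_clip Ropp (fun _ => -1)).
    - intros; apply continuous_slope_clip.
    - intros y _; split; [auto_derive; [exact I | ring] | apply continuous_const]. }
  rewrite Ropp_0 in H; rewrite <- H.
  rewrite (RInt_ext _ (fun y => scal (-1) (slope_clip y))) by (intros; now rewrite He).
  etransitivity; [apply (RInt_scal (V := R_CompleteNormedModule) slope_clip 0 x (-1))|].
  - apply (ex_RInt_continuous slope_clip); intros; apply continuous_slope_clip.
  - unfold scal; simpl; unfold mult; simpl; ring.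
Qed.

(** The solution [s] of [ds / s = 2 dx / ((1 - x^2) speed x)] with value 1 at
    [x = 0]. The case [beta = 0] is the stereographic projection of the round
    sphere. *)
Definition radius_sq (x : R) : R := (1 + x) * / (1 - x) * exp (expo x).
Definition dradius_sq (x : R) : R :=
  exp (expo x) * (2 + (1 - x * x) * slope_clip x) * / ((1 - x) * (1 - x)).

Lemma is_derive_radius_sq x : x < 1 -> is_derive radius_sq x (dradius_sq x).
Proof.
  intro H; unfold radius_sq, dradius_sq; pose proof (is_derive_expo x) as D.
  auto_derive.
  - repeat split; [lra | now exists (slope_clip x)].
  - replace (Derive (fun z => expo z) x) with (slope_clip x)
      by (symmetry; now apply is_derive_unique).
    field; lra.
Qed.

(** Where no clipping occurs this is [2 / speed]; elsewhere clipping has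
    increased [speed], and the quantity is larger than [2 / speed_clip]. *)
Lemma speed_balance x : 0 < 2 + (1 - x * x) * slope_clip x.
Proof.
  pose proof (speed_clip_pos x) as P.
  unfold slope_clip.
  assert (Hsq : speed_sq (1 - x * x) <= speed_clip x * speed_clip x).
  { unfold speed_clip; rewrite sqrt_sqrt; [apply Rmax_l|].
    left; eapply Rlt_le_trans; [apply floor_pos | apply Rmax_r]. }
  replace (2 + (1 - x * x) * (-2 * beta * geom l (1 - x * x) * / (speed_clip x * (1 + speed_clip x))))
    with ((2 * speed_clip x + 2 * (speed_clip x * speed_clip x - speed_sq (1 - x * x)) + 2) * / (speed_clip x * (1 + speed_clip x)))
    by (unfold speed_sq; field; lra).
  apply Rmult_lt_0_compat; [lra|]. apply Rinv_0_lt_compat; nra.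
Qed.

Lemma speed_slope x : -1 <= x <= 1 ->
  2 + (1 - x * x) * slope x = 2 * / speed x.
Proof.
  intro H; pose proof (speed_pos x H) as P.
  assert (Hsq : speed x * speed x = speed_sq (1 - x * x))
    by (apply sqrt_sqrt; left; now apply speed_sq_pos, tau_range).
  unfold slope. unfold speed_sq in Hsq.
  apply Rmult_eq_reg_r with (speed x * (1 + speed x)); [|nra].
  field_simplify; [|lra|lra]. nra.
Qed.

Lemma dradius_sq_pos x : x < 1 -> 0 < dradius_sq x.
Proof.
  intro H; unfold dradius_sq.
  apply Rmult_lt_0_compat; [apply Rmult_lt_0_compat; [apply exp_pos | apply speed_balance]|].
  apply Rinv_0_lt_compat; nra.
Qed.

Lemma radius_sq_incr x y : x < y -> y < 1 -> radius_sq x < radius_sq y.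
Proof.
  intros Hxy Hy; apply (incr_function radius_sq m_infty 1 dradius_sq); simpl; auto.
  - intros z _; apply is_derive_radius_sq.
  - intros z _; apply dradius_sq_pos.
Qed.

Lemma radius_sq_m1 : radius_sq (-1) = 0.
Proof. unfold radius_sq; replace (1 + -1) with 0 by ring; ring. Qed.

(** The reflection [x -> - x] of the sphere in its equator is [z -> 1 / z] up to
    conjugation, because [speed] is even. *)
Lemma radius_sq_opp x : -1 < x < 1 -> radius_sq (- x) = / radius_sq x.
Proof.
  intro H; unfold radius_sq; rewrite expo_odd, exp_Ropp.
  field; repeat split; try lra. apply Rgt_not_eq, exp_pos.
Qed.

(** The inverse of [radius_sq]. The range starts at -2 in order that the inverse
    be defined on a neighbourhood of [s = 0], which corresponds to [x = -1]. *)
Definition latitude (s : R) : R :=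
  epsilon (inhabits 0) (fun x => -2 < x < 1 /\ radius_sq x = s).

Lemma latitude_spec s : radius_sq (-2) < s -> -2 < latitude s < 1 /\ radius_sq (latitude s) = s.
Proof.
  intro Hs; apply (epsilon_spec (inhabits 0) (fun x => -2 < x < 1 /\ radius_sq x = s)).
  (* The equation [radius_sq x = s] multiplied by [1 - x] has no pole at [x = 1],
     so that the intermediate value theorem applies up to that point. *)
  set (f := fun x => (1 + x) * exp (expo x) - s * (1 - x)).
  assert (Hc : continuity f).
  { intro x; apply continuity_pt_filterlim; apply (ex_derive_continuous f).
    unfold f; auto_derive. eexists; apply is_derive_expo. }
  assert (Hm : f (-2) < 0).
  { unfold f; unfold radius_sq in Hs. replace (/ (1 - -2)) with (/ 3) in Hs by (f_equal; ring). lra. }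
  assert (Hp : 0 < f 1).
  { unfold f; pose proof (exp_pos (expo 1)); lra. }
  destruct (IVT f (-2) 1 Hc ltac:(lra) Hm Hp) as [x [Hx Ex]].
  assert (x <> -2) by (intros ->; lra). assert (x <> 1) by (intros ->; lra).
  exists x; split; [lra|]. unfold f in Ex; unfold radius_sq.
  apply Rmult_eq_reg_r with (1 - x); [|lra]. field_simplify; [|lra]. lra.
Qed.

Lemma latitude_unique s x : -2 < x < 1 -> radius_sq x = s -> latitude s = x.
Proof.
  intros Hx E.
  assert (Hs : radius_sq (-2) < s) by (rewrite <- E; apply radius_sq_incr; lra).
  destruct (latitude_spec s Hs) as [H1 H2].
  destruct (Rtotal_order (latitude s) x) as [L|[L|L]]; [|exact L|].
  - pose proof (radius_sq_incr _ _ L ltac:(lra)); lra.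
  - pose proof (radius_sq_incr _ _ L ltac:(lra)); lra.
Qed.

Lemma radius_sq_m2_neg : radius_sq (-2) < 0.
Proof. rewrite <- radius_sq_m1; apply radius_sq_incr; lra. Qed.

Lemma latitude_range s : 0 <= s -> -1 <= latitude s < 1 /\ radius_sq (latitude s) = s.
Proof.
  intro Hs; pose proof radius_sq_m2_neg.
  destruct (latitude_spec s ltac:(lra)) as [H1 H2]; repeat split; try tauto.
  destruct (Rlt_dec (latitude s) (-1)) as [L|L]; [|lra].
  pose proof (radius_sq_incr _ _ L ltac:(lra)); rewrite radius_sq_m1 in *; lra.
Qed.

Lemma latitude_1 : latitude 1 = 0.
Proof.
  apply latitude_unique; [lra|]. unfold radius_sq; rewrite expo_0, exp_0; field.
Qed.

Lemma latitude_inv s : 0 < s -> latitude (/ s) = - latitude s.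
Proof.
  intro Hs; destruct (latitude_range s ltac:(lra)) as [H E].
  assert (latitude s <> -1) by (intro Q; rewrite Q, radius_sq_m1 in E; lra).
  apply latitude_unique; [lra|]. rewrite radius_sq_opp by lra. now rewrite E.
Qed.

(** The conformal factor [(1 - x^2) / s] up to a constant, written without the
    quotient that is undefined at [s = 0]. *)
Definition dens (s : R) : R :=
  (1 - latitude s) * (1 - latitude s) * exp (- expo (latitude s)).

Lemma dens_pos s : 0 <= s -> 0 < dens s.
Proof.
  intro Hs; destruct (latitude_range s Hs) as [H _]; unfold dens.
  apply Rmult_lt_0_compat; [nra | apply exp_pos].
Qed.

Lemma dens_latitude s : radius_sq (-2) < s -> s * dens s = 1 - latitude s * latitude s.
Proof.
  intro Hs; destruct (latitude_spec s Hs) as [H E]; unfold dens.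
  rewrite <- E at 1; unfold radius_sq; rewrite exp_Ropp; field; split; [|lra].
  apply Rgt_not_eq, exp_pos.
Qed.

(** The symmetry that makes the two charts of the sphere play the same role. *)
Lemma dens_inv s : 0 < s -> dens (/ s) = s * s * dens s.
Proof.
  intro Hs; pose proof radius_sq_m2_neg.
  assert (Hi : 0 < / s) by now apply Rinv_0_lt_compat.
  pose proof (dens_latitude s ltac:(lra)) as D1.
  pose proof (dens_latitude (/ s) ltac:(lra)) as D2.
  rewrite latitude_inv in D2 by exact Hs.
  replace (dens (/ s)) with (s * (/ s * dens (/ s))) by (field; lra).
  rewrite D2; replace (- latitude s * - latitude s) with (latitude s * latitude s) by ring.
  rewrite <- D1; ring.
Qed.

Lemma is_derive_latitude s : 0 <= s ->
  is_derive latitude s (speed (latitude s) * dens s / 2).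
Proof.
  intro Hs; destruct (latitude_range s Hs) as [H E].
  pose proof radius_sq_m2_neg as N.
  assert (D : is_derive latitude s (/ dradius_sq (latitude s))).
  { apply (is_derive_inverse radius_sq dradius_sq latitude (-2) 1).
    - intros x Hx; apply is_derive_radius_sq; lra.
    - intros x Hx; apply dradius_sq_pos; lra.
    - apply (filter_imp (fun z => radius_sq (-2) < z)); [apply latitude_spec | apply open_gt; lra]. }
  replace (speed (latitude s) * dens s / 2) with (/ dradius_sq (latitude s)); [exact D|].
  unfold dradius_sq, dens; rewrite slope_clip_slope, speed_slope by lra.
  pose proof (speed_pos (latitude s) ltac:(lra)).
  rewrite exp_Ropp; field; repeat split; try lra. apply Rgt_not_eq, exp_pos.
Qed.

Lemma is_derive_speed x : -1 <= x <= 1 ->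
  is_derive speed x (- x * dspeed_sq (1 - x * x) * / speed x).
Proof.
  intro H; pose proof (speed_sq_pos _ (tau_range x H)) as P.
  unfold speed; auto_derive.
  - repeat split; [eexists; apply is_derive_speed_sq | exact P].
  - replace (Derive (fun z => speed_sq z) (1 + - (x * x))) with (dspeed_sq (1 - x * x))
      by (symmetry; apply is_derive_unique, is_derive_speed_sq).
    change (1 + - (x * x)) with (1 - x * x). field.
    apply Rgt_not_eq, sqrt_lt_R0, P.
Qed.

Lemma ex_derive_slope x : -1 <= x <= 1 -> ex_derive slope x.
Proof.
  intro H; pose proof (speed_pos x H) as P.
  assert (D : ex_derive speed x) by (eexists; now apply is_derive_speed).
  unfold slope; auto_derive; repeat split; try exact D.
  - eexists; apply is_derive_geom.
  - nra.
Qed.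

(** The logarithmic derivative of [dens]. *)
Definition ldens (s : R) : R :=
  let x := latitude s in
  - (2 * (1 - x) + (1 - x) * (1 - x) * slope x) * exp (- expo x) * speed x / 2.

Lemma is_derive_dens s : 0 <= s -> is_derive dens s (dens s * ldens s).
Proof.
  intro Hs; destruct (latitude_range s Hs) as [H E].
  pose proof (is_derive_latitude s Hs) as DL.
  pose proof (is_derive_expo (latitude s)) as DE.
  rewrite slope_clip_slope in DE by lra.
  unfold dens at 1; auto_derive.
  - repeat split; eexists; eassumption.
  - replace (Derive (fun z => latitude z) s) with (speed (latitude s) * dens s / 2)
      by (symmetry; now apply is_derive_unique).
    replace (Derive (fun z => expo z) (latitude s)) with (slope (latitude s))
      by (symmetry; now apply is_derive_unique).
    unfold ldens; cbv zeta; unfold dens; field.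
Qed.

Lemma ex_derive_ldens s : 0 <= s -> ex_derive ldens s.
Proof.
  intro Hs; destruct (latitude_range s Hs) as [H E].
  pose proof (is_derive_latitude s Hs) as DL.
  pose proof (is_derive_expo (latitude s)) as DE.
  pose proof (ex_derive_slope (latitude s) ltac:(lra)) as DS.
  pose proof (is_derive_speed (latitude s) ltac:(lra)) as DP.
  unfold ldens; auto_derive; repeat split; try exact DS; eexists; eassumption.
Qed.

(** The next identity is differentiated at [s = 0] too, hence must hold on a
    two-sided neighbourhood, where the latitude may be less than -1. *)
Lemma locally_speed s : 0 <= s ->
  locally s (fun z => radius_sq (-2) < z /\ 0 < speed_sq (1 - latitude z * latitude z)).
Proof.
  intro Hs; destruct (latitude_range s Hs) as [H E]; pose proof radius_sq_m2_neg.
  apply filter_and; [apply open_gt; lra|].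
  assert (Hc : continuous (fun z => speed_sq (1 - latitude z * latitude z)) s).
  { apply (ex_derive_continuous (fun z => speed_sq (1 - latitude z * latitude z))).
    pose proof (is_derive_latitude s Hs) as DL.
    auto_derive; repeat split; try (eexists; eassumption).
    eexists; apply is_derive_speed_sq. }
  apply (Hc (fun y => 0 < y)), (open_gt 0), speed_sq_pos, tau_range; lra.
Qed.

Lemma ldens_identity s : radius_sq (-2) < s -> 0 < speed_sq (1 - latitude s * latitude s) ->
  s * ldens s = - 1 - latitude s * speed (latitude s).
Proof.
  intros Hs HP; destruct (latitude_spec s Hs) as [H E].
  pose proof (dens_latitude s Hs) as D.
  unfold ldens; cbv zeta; set (x := latitude s) in *.
  assert (P : 0 < speed x) by now apply sqrt_lt_R0.
  assert (Hsq : speed x * speed x = speed_sq (1 - x * x)) by (apply sqrt_sqrt; lra).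
  assert (Hslope : (1 - x * x) * slope x * speed x = 2 - 2 * speed x).
  { unfold slope. unfold speed_sq in Hsq.
    apply Rmult_eq_reg_r with (1 + speed x); [|lra].
    field_simplify; [|lra]. nra. }
  unfold dens in D; fold x in D.
  apply Rmult_eq_reg_r with (1 - x); [|lra].
  replace (s * (- (2 * (1 - x) + (1 - x) * (1 - x) * slope x) * exp (- expo x) * speed x / 2) * (1 - x))
    with (- (s * ((1 - x) * (1 - x) * exp (- expo x))) * (2 + (1 - x) * slope x) * speed x / 2) by field.
  rewrite D.
  replace (- (1 - x * x) * (2 + (1 - x) * slope x) * speed x / 2)
    with (- (1 - x * x) * speed x - (1 - x) * ((1 - x * x) * slope x * speed x) / 2) by field.
  rewrite Hslope; field.
Qed.

(** The left-hand side is [(s (log dens)')'], that is, a quarter of the flat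
    Laplacian of [log dens]. Differentiating [s ldens = - 1 - x speed x]
    gives it without any second derivative of [dens]. *)
Lemma ldens_curvature s : 0 <= s ->
  ldens s + s * Derive ldens s =
  - (1 - beta + (INR l + 1) * beta * (s * dens s) ^ l) * dens s / 2.
Proof.
  intro Hs; destruct (latitude_range s Hs) as [H E].
  pose proof (is_derive_latitude s Hs) as DL.
  pose proof (is_derive_speed (latitude s) ltac:(lra)) as DP.
  pose proof (speed_pos (latitude s) ltac:(lra)) as P.
  pose proof radius_sq_m2_neg as N.
  rewrite (dens_latitude s) by lra.
  assert (D1 : is_derive (fun z => z * ldens z) s (ldens s + s * Derive ldens s)).
  { pose proof (ex_derive_ldens s Hs). auto_derive; [tauto|]. change (Derive (fun x => ldens x) s) with (Derive ldens s). ring. }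
  assert (D2 : is_derive (fun z => z * ldens z) s
     (- (speed (latitude s) * dens s / 2) *
       (speed (latitude s) + latitude s * (- latitude s * dspeed_sq (1 - latitude s * latitude s) * / speed (latitude s))))).
  { apply is_derive_ext_loc with (f := fun z => - 1 - latitude z * speed (latitude z)).
    - generalize (locally_speed s Hs); apply filter_imp; intros z [Hz1 Hz2].
      symmetry; now apply ldens_identity.
    - auto_derive; [repeat split; eexists; eassumption|].
      replace (Derive (fun z => latitude z) s) with (speed (latitude s) * dens s / 2)
        by (symmetry; now apply is_derive_unique).
      replace (Derive (fun z => speed z) (latitude s)) with
        (- latitude s * dspeed_sq (1 - latitude s * latitude s) * / speed (latitude s))
        by (symmetry; now apply is_derive_unique).
      field; lra. }
  rewrite <- (is_derive_unique _ _ _ D1), (is_derive_unique _ _ _ D2).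
  set (x := latitude s) in *.
  assert (Hsq : speed x * speed x = speed_sq (1 - x * x))
    by (apply sqrt_sqrt; left; apply speed_sq_pos, tau_range; lra).
  replace (- (speed x * dens s / 2) * (speed x + x * (- x * dspeed_sq (1 - x * x) * / speed x)))
    with (- (speed x * speed x - x * x * dspeed_sq (1 - x * x)) * dens s / 2) by (field; lra).
  rewrite Hsq. do 3 f_equal.
  set (t := 1 - x * x). replace (x * x) with (1 - t) by (unfold t; ring).
  unfold speed_sq, dspeed_sq.
  pose proof (geom_sum l t) as G1; pose proof (dgeom_sum l t) as G2. 
  replace (1 + beta * (t * geom l t) - (1 - t) * (beta * (geom l t + t * dgeom l t)))
    with (1 - beta * ((1 - t) * geom l t) - beta * (t * ((1 - t) * dgeom l t - geom l t))) by ring.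
  rewrite G1, G2; ring.
Qed.

End Profile.

(** * The generalized Ricci equation and smoothness of the solutions *)

Section Solution.

Variables (l : nat) (beta c : R).
Hypothesis (hl : (1 <= l)%nat) (hbeta : 0 < 1 + beta * INR l) (hc : c <> 0)
  (hscale : 0 < (1 - beta) / c).

Let W := dens l beta.
Let A := ldens l beta.

(** The value of [scale] makes the constant term of the curvature equal to [c];
    [amplitude] is then the value of [K - c] on the equator. *)
Definition scale : R := (1 - beta) / c.
Definition amplitude : R := (INR l + 1) * c * beta / (1 - beta).
Definition factor (s : R) : R := scale * dens l beta s.
Definition dfactor (s : R) : R := scale * (W s * A s).
Definition ddfactor (s : R) : R := scale * (W s * A s * A s + W s * Derive A s).
Definition curv (s : R) : R := c + amplitude * (s * dens l beta s) ^ l.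

Lemma beta_neq1 : 1 - beta <> 0.
Proof. intro Z; rewrite Z in hscale; unfold Rdiv in hscale; lra. Qed.

Lemma factor_pos s : 0 <= s -> 0 < factor s.
Proof.
  intro Hs; apply Rmult_lt_0_compat; [exact hscale | now apply dens_pos].
Qed.

Lemma is_derive_dens2 s : 0 <= s ->
  is_derive (fun z => W z * A z) s (W s * A s * A s + W s * Derive A s).
Proof.
  intro Hs; pose proof (is_derive_dens l beta hbeta s Hs) as DW.
  pose proof (Derive_correct _ _ (ex_derive_ldens l beta hbeta s Hs)) as DA.
  apply (is_derive_mult W A s); [exact DW | exact DA | intros; apply Rmult_comm].
Qed.

Lemma factor_twice_derivable : twice_derivable factor dfactor ddfactor.
Proof.
  intros s Hs; split; apply is_derive_scal;
    [now apply is_derive_dens | now apply is_derive_dens2].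
Qed.

Lemma factor_curvature s : 0 <= s ->
  radial_curvature factor dfactor ddfactor s = curv s.
Proof.
  intro Hs; pose proof (ldens_curvature l beta hbeta s Hs) as HA.
  fold W A in HA.
  pose proof (dens_pos l beta hbeta s Hs) as HW. fold W in HW.
  pose proof beta_neq1 as Hb.
  unfold radial_curvature, factor, dfactor, ddfactor, curv. fold W.
  assert (Hscale : scale <> 0) by (apply Rgt_not_eq, hscale).
  transitivity (- 2 * (A s + s * Derive A s) / (scale * W s)).
  - field; split; lra.
  - rewrite HA; unfold scale, amplitude; field; repeat split; lra.
Qed.

(* [curv = c + amplitude T^(n+1)]; the exponent is written [n + 1] for the sake
   of its derivatives. *)
Let n := pred l.
Let T s := s * W s.
Let T1 s := W s * (1 + s * A s).
Let T2 s := 2 * W s * A s + s * (W s * A s * A s + W s * Derive A s).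

Definition dcurv (s : R) : R := amplitude * ((INR n + 1) * (T s ^ n * T1 s)).
Definition ddcurv (s : R) : R :=
  amplitude * ((INR n + 1) * (INR n * T s ^ pred n * T1 s * T1 s + T s ^ n * T2 s)).

Lemma curv_twice_derivable : twice_derivable curv dcurv ddcurv.
Proof.
  assert (HT : forall s, 0 <= s -> is_derive T s (T1 s)).
  { intros s Hs; pose proof (is_derive_dens l beta hbeta s Hs) as DW.
    unfold T, T1; evar_last; [apply (is_derive_mult (fun z => z) W s);
      [apply (is_derive_id (K := R_AbsRing)) | exact DW | intros; apply Rmult_comm]|].
    unfold plus, mult, one; simpl; unfold W, A; ring. }
  assert (HT1 : forall s, 0 <= s -> is_derive T1 s (T2 s)).
  { intros s Hs; pose proof (is_derive_dens2 s Hs) as D2.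
    pose proof (is_derive_dens l beta hbeta s Hs) as DW.
    apply is_derive_ext with (f := fun z => W z + z * (W z * A z)).
    { intro z; unfold T1; simpl; ring. }
    evar_last; [apply (is_derive_plus (V := R_NormedModule) W); [exact DW|];
      apply (is_derive_mult (fun z => z) (fun z => W z * A z) s);
      [apply (is_derive_id (K := R_AbsRing)) | exact D2 | intros; apply Rmult_comm]|].
    unfold plus, mult, one; simpl; unfold T2, W, A; ring. }
  assert (Hl : l = S n) by (unfold n; lia).
  intros s Hs; specialize (HT s Hs); specialize (HT1 s Hs); split.
  - apply is_derive_ext with (f := fun z => c + amplitude * T z ^ (S n)).
    { intro z; unfold curv, T, W; now rewrite <- Hl. }
    evar_last; [apply (is_derive_plus (V := R_NormedModule) (fun _ => c));
      [apply (is_derive_const (V := R_NormedModule)) | apply is_derive_scal, is_derive_pow, HT]|].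
    unfold dcurv; rewrite <- S_INR; unfold plus, zero; simpl; ring.
  - unfold dcurv, ddcurv; auto_derive; [repeat split; eexists; eassumption|].
    replace (Derive (fun x => T x) s) with (T1 s) by (symmetry; now apply is_derive_unique).
    replace (Derive (fun x => T1 x) s) with (T2 s) by (symmetry; now apply is_derive_unique).
    ring.
Qed.

(** With [u = K - c = amplitude T^l], the equation reads
    [u Delta u - |grad u|^2 + 2 l K u^2 = 0], that is,
    [Delta (log |u|) = - 2 l K] where [u] does not vanish. Here
    [T = s dens s] and [log s] is harmonic, so that both sides
    equal [l Delta (log dens)]. The computation is polynomial in order to cover
    the poles, where [u = 0]. *)
Lemma factor_generalized_ricci :
  generalized_ricci_coord (- 2 * INR l) 0 c (conf (fun q => factor (nsq q))).
Proof.
  apply (generalized_ricci_radial factor dfactor ddfactor curv dcurv ddcurv).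
  - apply factor_twice_derivable.
  - apply factor_pos.
  - apply curv_twice_derivable.
  - apply factor_curvature.
  - intros s Hs.
    pose proof (ldens_curvature l beta hbeta s Hs) as HA. fold W A in HA.
    assert (Hl : l = S n) by (unfold n; lia).
    assert (Hk : factor s * curv s = - 2 * (A s + s * Derive A s)).
    { rewrite HA; unfold factor, curv, scale, amplitude; fold W.
      pose proof beta_neq1. field; split; assumption. }
    assert (Hkc : curv s - c = amplitude * (T s * T s ^ n)).
    { unfold curv; fold W; change (s * W s) with (T s). rewrite Hl at 1.
      simpl; ring. }
    assert (HlR : INR l = INR n + 1) by (rewrite Hl at 1; apply S_INR).
    (* This absorbs the exponent [pred n], which is off by one when [n = 0]. *)
    assert (HY : T s * (INR n * T s ^ pred n) = INR n * T s ^ n).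
    { destruct n; simpl; ring. }
    replace (c - curv s) with (- (curv s - c)) by ring.
    replace (factor s * (-2 * INR l * curv s + 0) * (curv s - c) ^ 2)
      with (-2 * INR l * (factor s * curv s) * (curv s - c) ^ 2) by ring.
    rewrite Hk, Hkc, HlR; unfold dcurv, ddcurv.
    set (Z := T s ^ n) in *. set (Y := INR n * T s ^ pred n) in *.
    set (k := INR n) in *.
    replace (- (amplitude * (T s * Z)) *
       (s * (amplitude * ((k + 1) * (Y * T1 s * T1 s + Z * T2 s))) + amplitude * ((k + 1) * (Z * T1 s))))
     with (- (amplitude * amplitude * (k + 1)) * Z *
       (s * (T s * Y) * T1 s * T1 s + T s * Z * (s * T2 s + T1 s))) by ring.
    rewrite HY. unfold T1, T2, T; ring.
Qed.

(** The latitude and [exp (- expo)] of it satisfy a first order system whose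
    coefficients involve only themselves, the coordinates and the algebraic
    functions [speed] and [slope]. *)
Let xi (q : C) : R := latitude l beta (nsq q).
Let om (q : C) : R := exp (- expo l beta (xi q)).

Definition profile_base (f : C -> R) : Prop := f = xi \/ f = om.

Lemma gen_ext B f g : generated B f -> (forall q, f q = g q) -> generated B g.
Proof. intros H E; replace g with f; [exact H | now apply functional_extensionality]. Qed.

Lemma gen_xi : generated profile_base xi.
Proof. apply gen_base; now left. Qed.

Lemma gen_om : generated profile_base om.
Proof. apply gen_base; now right. Qed.

Lemma xi_range q : -1 <= xi q < 1.
Proof. exact (proj1 (latitude_range l beta hbeta _ (nsq_ge0 q))). Qed.

Lemma gen_minus B f g : generated B f -> generated B g -> generated B (fun q => f q - g q).
Proof.
  intros Hf Hg; apply gen_ext with (f := fun q => f q + (-1) * g q); [|intro; ring].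
  apply gen_plus; [exact Hf | apply gen_mult; [apply gen_const | exact Hg]].
Qed.

Lemma gen_geom B m f : generated B f -> generated B (fun q => geom m (f q)).
Proof.
  intro Hf; induction m as [|m IH]; simpl; [apply gen_const|].
  apply (gen_plus _ (fun _ => 1)); [apply gen_const | now apply gen_mult].
Qed.

Lemma gen_tau : generated profile_base (fun q => 1 - xi q * xi q).
Proof.
  apply (gen_minus _ (fun _ => 1)); [apply gen_const | apply gen_mult; apply gen_xi].
Qed.

Lemma gen_speed : generated profile_base (fun q => speed l beta (xi q)).
Proof.
  apply gen_sqrt.
  - intro q; apply speed_sq_pos; [exact hbeta|]; apply tau_range; pose proof (xi_range q); lra.
  - unfold speed_sq; apply (gen_plus _ (fun _ => 1)); [apply gen_const|].
    apply (gen_mult _ (fun _ => beta)); [apply gen_const|].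
    apply (gen_mult _ (fun q => 1 - xi q * xi q) (fun q => geom l (1 - xi q * xi q)));
      [apply gen_tau | apply (gen_geom _ l _ gen_tau)].
Qed.

Lemma gen_slope : generated profile_base (fun q => slope l beta (xi q)).
Proof.
  unfold slope.
  apply (gen_mult _ (fun q => -2 * beta * geom l (1 - xi q * xi q))).
  - apply (gen_mult _ (fun _ => -2 * beta)); [apply gen_const | apply (gen_geom _ l _ gen_tau)].
  - apply gen_inv.
    + intro q; pose proof (speed_pos l beta hbeta (xi q)) as P; pose proof (xi_range q).
      specialize (P ltac:(lra)); nra.
    + apply (gen_mult _ (fun q => speed l beta (xi q)) (fun q => 1 + speed l beta (xi q)));
       [apply gen_speed | apply (gen_plus _ (fun _ => 1)); [apply gen_const | apply gen_speed]].
Qed.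

Lemma gen_dens : generated profile_base (fun q => dens l beta (nsq q)).
Proof.
  apply (gen_mult _ (fun q => (1 - xi q) * (1 - xi q)) om); [|apply gen_om].
  apply gen_mult; apply (gen_minus _ (fun _ => 1)); first [apply gen_const | apply gen_xi].
Qed.

Lemma is_partial_xi a q :
  is_partial a xi q (speed l beta (xi q) * dens l beta (nsq q) / 2 * (2 * comp a q)).
Proof.
  apply (is_partial_comp1 a (latitude l beta)); [|apply is_partial_nsq].
  apply is_derive_latitude; [exact hbeta | apply nsq_ge0].
Qed.

Lemma is_derive_om x : -1 <= x <= 1 ->
  is_derive (fun z => exp (- expo l beta z)) x (- slope l beta x * exp (- expo l beta x)).
Proof.
  intro H; pose proof (is_derive_expo l beta hbeta x) as DE.
  rewrite slope_clip_slope in DE by assumption.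
  auto_derive; [eexists; exact DE|].
  replace (Derive (fun z => expo l beta z) x) with (slope l beta x)
    by (symmetry; now apply is_derive_unique).
  ring.
Qed.

Lemma continuous_nsq (q : C) : continuous nsq q.
Proof.
  apply (continuous_plus (V := R_NormedModule) (fun z : C => comp ax z * comp ax z) (fun z : C => comp ay z * comp ay z));
    apply (continuous_mult (K := R_AbsRing)); apply continuous_comp_axis.
Qed.

Lemma continuous_xi (q : C) : continuous xi q.
Proof.
  apply (continuous_comp nsq (latitude l beta)); [apply continuous_nsq|].
  apply (ex_derive_continuous (latitude l beta)); eexists.
  apply is_derive_latitude; [exact hbeta | apply nsq_ge0].
Qed.

Lemma profile_derivation_closed : derivation_closed profile_base.
Proof.
  assert (Gxi : forall a, generated profile_base
    (fun q => speed l beta (xi q) * dens l beta (nsq q) / 2 * (2 * comp a q))).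
  { intro a. apply (gen_mult _ (fun q => speed l beta (xi q) * dens l beta (nsq q) / 2) (fun q => 2 * comp a q)).
    - apply (gen_mult _ _ (fun _ => / 2)); [|apply gen_const].
      apply gen_mult; [apply gen_speed | apply gen_dens].
    - apply (gen_mult _ (fun _ => 2)); [apply gen_const | apply gen_coord]. }
  intros f [-> | ->]; (split; [|intro a]).
  - apply continuous_xi.
  - eexists; split; [apply (Gxi a) | apply is_partial_xi].
  - intro q; apply (continuous_comp xi (fun z => exp (- expo l beta z))); [apply continuous_xi|].
    apply (ex_derive_continuous (fun z => exp (- expo l beta z))); eexists; apply is_derive_om.
    pose proof (xi_range q); lra.
  - eexists; split; [|intro q; apply (is_partial_comp1 a (fun z => exp (- expo l beta z)));
      [apply is_derive_om; pose proof (xi_range q); lra | apply is_partial_xi]].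
    apply (gen_mult _ (fun q => - slope l beta (xi q) * exp (- expo l beta (xi q)))); [|apply Gxi].
    apply (gen_mult _ (fun q => - slope l beta (xi q)) om); [|apply gen_om].
    apply gen_ext with (f := fun q => -1 * slope l beta (xi q)); [|intro; ring].
    apply (gen_mult _ (fun _ => -1)); [apply gen_const | apply gen_slope].
Qed.

Lemma factor_smooth : smooth (fun q => factor (nsq q)).
Proof.
  apply (generated_smooth profile_base); [apply profile_derivation_closed|].
  apply (gen_mult _ (fun _ => scale)); [apply gen_const | apply gen_dens].
Qed.

End Solution.

(** * Rotations in the two charts and metrics on the sphere *)

(** The expressions of rotations in the charts: a product with a complex number
    of modulus 1, composed with [z -> 1 / z] if the charts differ. *)
Definition similarity (i j : chart) (w q : C) : C :=
  match i, j with
  | chart_z, chart_z | chart_w, chart_w => Cmult w q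
  | _, _ => Cmult w (Cinv q)
  end.

Definition same_chart (i j : chart) : bool :=
  match i, j with chart_z, chart_z | chart_w, chart_w => true | _, _ => false end.

Lemma nsq_0 q : nsq q = 0 -> q = RtoC 0.
Proof. destruct q as [x y]; unfold nsq; simpl; intro H; unfold RtoC; f_equal; nra. Qed.

Lemma nsq_neq0 q : q <> RtoC 0 -> 0 < nsq q.
Proof.
  intro H; destruct (Rle_lt_or_eq_dec _ _ (nsq_ge0 q)) as [L|L]; [exact L|].
  now destruct H; apply nsq_0.
Qed.

Lemma nsq_Cmult w q : nsq (Cmult w q) = nsq w * nsq q.
Proof. destruct w, q; unfold nsq; simpl; ring. Qed.

Lemma Cinv_eq q : Cinv q = (fst q * / nsq q, - snd q * / nsq q).
Proof.
  destruct q as [x y]; unfold Cinv, nsq; simpl.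
  now replace (x * (x * 1) + y * (y * 1)) with (x * x + y * y) by ring.
Qed.

Lemma nsq_Cinv q : q <> RtoC 0 -> nsq (Cinv q) = / nsq q.
Proof.
  intro H; pose proof (nsq_neq0 q H) as P; rewrite Cinv_eq.
  unfold nsq at 1; simpl.
  replace (fst q * / nsq q * (fst q * / nsq q) + - snd q * / nsq q * (- snd q * / nsq q))
    with (nsq q * (/ nsq q * / nsq q)) by (unfold nsq; ring).
  field; lra.
Qed.

Lemma Cinv_involutive q : q <> RtoC 0 -> Cinv (Cinv q) = q.
Proof.
  intro H; pose proof (nsq_neq0 q H) as P.
  rewrite (Cinv_eq (Cinv q)), nsq_Cinv by exact H; rewrite Cinv_eq.
  destruct q as [x y]; simpl; f_equal; field; lra.
Qed.

Lemma Cmult_unit_neq0 w q : nsq w = 1 -> q <> RtoC 0 -> Cmult w q <> RtoC 0.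
Proof.
  intros Hw Hq E; pose proof (nsq_neq0 q Hq) as P.
  pose proof (nsq_Cmult w q) as M; rewrite E, Hw in M.
  unfold nsq at 1 in M; simpl in M; lra.
Qed.

Lemma Cinv_unit_mult w q : nsq w = 1 -> q <> RtoC 0 ->
  Cinv (Cmult w q) = Cmult (Cconj w) (Cinv q).
Proof.
  intros Hw Hq. rewrite !Cinv_eq, nsq_Cmult, Hw.
  destruct w as [a b], q as [x y]; unfold Cmult, Cconj; simpl.
  rewrite !Rmult_1_l. f_equal; ring.
Qed.

Lemma sphere_inv_some q : q <> RtoC 0 -> sphere_inv (Some q) = Some (Cinv q).
Proof. intro H; simpl; now destruct (Ceq_dec q (RtoC 0)). Qed.

Lemma sphere_inv_0 : sphere_inv (Some (RtoC 0)) = None.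
Proof. simpl; now destruct (Ceq_dec (RtoC 0) (RtoC 0)). Qed.

Lemma Cinv_neq0 q : q <> RtoC 0 -> Cinv q <> RtoC 0.
Proof.
  intros Hq E; pose proof (nsq_neq0 q Hq) as P; pose proof (nsq_Cinv q Hq) as H.
  rewrite E in H; unfold nsq at 1 in H; simpl in H.
  pose proof (Rinv_0_lt_compat _ P); lra.
Qed.

Lemma read_rotation (theta : R) (i j : chart) :
  exists w : C, nsq w = 1 /\
    forall q, (same_chart i j = true \/ q <> RtoC 0) ->
      read_map (rotation theta) i j q = similarity i j w q.
Proof.
  set (w := (cos theta, sin theta) : C).
  assert (Hw : nsq w = 1).
  { unfold nsq, w; simpl. pose proof (sin2_cos2 theta) as S; unfold Rsqr in S; lra. }
  assert (Hw' : nsq (Cconj w) = 1) by (rewrite <- Hw; unfold nsq; simpl; ring).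
  destruct i, j; simpl.
  - exists w; split; [exact Hw | reflexivity].
  - exists (Cconj w); split; [exact Hw'|]; intros q [H|H]; [discriminate|].
    unfold read_map, param, rotation, coord.
    rewrite sphere_inv_some by now apply Cmult_unit_neq0.
    now apply Cinv_unit_mult.
  - exists w; split; [exact Hw|]; intros q [H|H]; [discriminate|].
    unfold read_map, param, coord; now rewrite sphere_inv_some.
  - exists (Cconj w); split; [exact Hw'|]; intros q _.
    unfold read_map, param, coord.
    destruct (Ceq_dec q (RtoC 0)) as [->|Hq].
    + rewrite sphere_inv_0. simpl rotation. simpl sphere_inv.
      unfold Cmult, RtoC; simpl; f_equal; ring.
    + rewrite sphere_inv_some by exact Hq. simpl rotation; fold w.
      rewrite sphere_inv_some by (apply Cmult_unit_neq0; [exact Hw | now apply Cinv_neq0]).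
      rewrite Cinv_unit_mult by (try exact Hw; now apply Cinv_neq0).
      now rewrite Cinv_involutive.
Qed.

Lemma dom_rotation theta i j p :
  dom j (rotation theta (param i p)) -> same_chart i j = true \/ p <> RtoC 0.
Proof.
  intro H; destruct i, j; simpl; [now left| | |now left]; right; intros ->.
  - apply H; simpl; f_equal; unfold Cmult, RtoC; simpl; f_equal; ring.
  - unfold param in H; rewrite sphere_inv_0 in H; now apply H.
Qed.

Lemma locally_neq0 (p : C) : p <> RtoC 0 -> locally p (fun q : C => q <> RtoC 0).
Proof.
  intro H.
  apply (filter_imp (fun q : C => 0 < nsq q)).
  - intros q Hq ->; unfold nsq in Hq; simpl in Hq; lra.
  - apply (continuous_nsq p (fun y => 0 < y)), (open_gt 0), nsq_neq0, H.
Qed.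

Lemma pullback_ext_loc (phi psi : C -> C) g a b p :
  locally p (fun q : C => phi q = psi q) -> pullback phi g a b p = pullback psi g a b p.
Proof.
  intro H; unfold pullback, sum2.
  assert (E : forall i k, partial i (fun q => comp k (phi q)) p = partial i (fun q => comp k (psi q)) p).
  { intros i k; pose proof (locally_section i p _ H) as Hi.
    destruct i; apply Derive_ext_loc; revert Hi; apply filter_imp; intros t Ht; exact (f_equal (comp k) Ht). }
  now rewrite !E, (locally_singleton _ _ H).
Qed.

(** The hypothesis on [f] states that the metric is invariant under
    [z -> 1 / z], whose derivative has the squared modulus [1 / |z|^4]. *)
Lemma pullback_similarity (f : R -> R) i j w p a b :
  (forall s, 0 < s -> f (/ s) = s * s * f s) ->
  nsq w = 1 -> (same_chart i j = true \/ p <> RtoC 0) ->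
  conf (fun z => f (nsq z)) a b p = pullback (similarity i j w) (conf (fun z => f (nsq z))) a b p.
Proof.
  intros Hf Hw Hp; rewrite pullback_conf.
  assert (Cx : forall a p, is_partial a fst p (kron a ax)) by (intros; apply (is_partial_comp_axis a0 ax)).
  assert (Cy : forall a p, is_partial a snd p (kron a ay)) by (intros; apply (is_partial_comp_axis a0 ay)).
  assert (Same : conf (fun z => f (nsq z)) a b p = f (nsq (Cmult w p)) *
   (partial a (fun z => fst (Cmult w z)) p * partial b (fun z => fst (Cmult w z)) p
    + partial a (fun z => snd (Cmult w z)) p * partial b (fun z => snd (Cmult w z)) p)).
  { rewrite nsq_Cmult, Hw, Rmult_1_l.
    assert (D1 : forall a, partial a (fun z => fst (Cmult w z)) p = fst w * kron a ax + - snd w * kron a ay).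
    { intro a0; apply is_partial_unique.
      apply is_partial_ext_loc with (f := fun z => fst w * fst z + - snd w * snd z).
      - apply filter_forall; intro z; unfold Cmult; simpl; ring.
      - apply is_partial_plus; apply is_partial_scal; auto. }
    assert (D2 : forall a, partial a (fun z => snd (Cmult w z)) p = snd w * kron a ax + fst w * kron a ay).
    { intro a0; apply is_partial_unique.
      apply is_partial_ext_loc with (f := fun z => snd w * fst z + fst w * snd z).
      - apply filter_forall; intro z; unfold Cmult; simpl; ring.
      - apply is_partial_plus; apply is_partial_scal; auto. }
    rewrite !D1, !D2. unfold nsq at 1 in Hw.
    destruct a, b; simpl; try ring;
     (transitivity (f (nsq p) * (fst w * fst w + snd w * snd w)); [rewrite Hw; ring | ring]). }
  assert (Diff : p <> RtoC 0 -> conf (fun z => f (nsq z)) a b p = f (nsq (Cmult w (Cinv p))) *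
   (partial a (fun z => fst (Cmult w (Cinv z))) p * partial b (fun z => fst (Cmult w (Cinv z))) p
    + partial a (fun z => snd (Cmult w (Cinv z))) p * partial b (fun z => snd (Cmult w (Cinv z))) p)).
  { clear Hp; intro Hp; pose proof (nsq_neq0 p Hp) as P.
    rewrite nsq_Cmult, Hw, Rmult_1_l, nsq_Cinv, Hf by assumption.
    assert (DI : forall a, is_partial a (fun q => / nsq q) p (- / (nsq p * nsq p) * (2 * comp a p)))
      by (intro; apply is_partial_inv; [lra | apply is_partial_nsq]).
    assert (D1 : forall a, partial a (fun z => fst (Cmult w (Cinv z))) p =
       (fst w * kron a ax + snd w * kron a ay) * / nsq p
       + (fst w * fst p + snd w * snd p) * (- / (nsq p * nsq p) * (2 * comp a p))).
    { intro a0; apply is_partial_unique.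
      apply is_partial_ext_loc with (f := fun z => (fst w * fst z + snd w * snd z) * / nsq z).
      - apply filter_forall; intro z; rewrite Cinv_eq; unfold Cmult; simpl; ring.
      - apply is_partial_mult; [|apply DI]. apply is_partial_plus; apply is_partial_scal; auto. }
    assert (D2 : forall a, partial a (fun z => snd (Cmult w (Cinv z))) p =
       (snd w * kron a ax + - fst w * kron a ay) * / nsq p
       + (snd w * fst p + - fst w * snd p) * (- / (nsq p * nsq p) * (2 * comp a p))).
    { intro a0; apply is_partial_unique.
      apply is_partial_ext_loc with (f := fun z => (snd w * fst z + - fst w * snd z) * / nsq z).
      - apply filter_forall; intro z; rewrite Cinv_eq; unfold Cmult; simpl; ring.
      - apply is_partial_mult; [|apply DI]. apply is_partial_plus; apply is_partial_scal; auto. }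
    rewrite !D1, !D2.
    destruct p as [x y], w as [u v]. unfold nsq in Hw, P; simpl in Hw, P.
    set (F := f (nsq (x, y))). unfold nsq; simpl.
    destruct a, b; simpl; unfold nsq in F; simpl in F; fold F.
    - transitivity (F * (u * u + v * v)); [rewrite Hw; ring | field; lra].
    - field; lra.
    - field; lra.
    - transitivity (F * (u * u + v * v)); [rewrite Hw; ring | field; lra]. }
  destruct i, j; simpl; first [exact Same | apply Diff; destruct Hp as [Hp|Hp]; [discriminate | exact Hp]].
Qed.

(** For [theta = 0] this is the compatibility of the two charts. *)
Lemma rotation_pulls_back (f : R -> R) theta :
  (forall s, 0 < s -> f (/ s) = s * s * f s) ->
  pulls_back (rotation theta) (fun _ => conf (fun z => f (nsq z))) (fun _ => conf (fun z => f (nsq z))).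
Proof.
  intros Hf i j p Hdom a b.
  destruct (read_rotation theta i j) as [w [Hw Hread]].
  apply dom_rotation in Hdom.
  rewrite (pullback_ext_loc _ (similarity i j w)).
  - now apply pullback_similarity.
  - destruct Hdom as [H|H].
    + apply filter_forall; intro q; apply Hread; now left.
    + generalize (locally_neq0 p H); apply filter_imp; intros q Hq; apply Hread; now right.
Qed.

Lemma rotation_0 : rotation 0 = fun P => P.
Proof.
  apply functional_extensionality; intros [[x y]|]; [|reflexivity].
  simpl; rewrite cos_0, sin_0; unfold Cmult; simpl; apply f_equal, f_equal2; ring.
Qed.

Lemma conf_sym E a b p : conf E a b p = conf E b a p.
Proof. destruct a, b; reflexivity. Qed.

Lemma inner_conf_pos E p v : 0 < E p -> (exists a, v a <> 0) -> 0 < inner (conf E) p v v.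
Proof.
  intros H [a Ha]; unfold inner, sum2; simpl.
  replace (E p * v ax * v ax + 0 * v ax * v ay + (0 * v ay * v ax + E p * v ay * v ay))
    with (E p * (v ax * v ax + v ay * v ay)) by ring.
  apply Rmult_lt_0_compat; [exact H|]; destruct a; nra.
Qed.

Lemma conf_smooth E a b : smooth E -> smooth (conf E a b).
Proof.
  intro H; destruct a, b; simpl; try exact H;
  apply (generated_smooth (fun _ => False)); try easy; apply (gen_const _ 0).
Qed.

Section RadialMetric.

Variable f : R -> R.
Hypothesis (f_smooth : smooth (fun z => f (nsq z)))
  (f_pos : forall s, 0 <= s -> 0 < f s)
  (f_inv : forall s, 0 < s -> f (/ s) = s * s * f s).

Definition radial_metric : sphere_metric.
Proof.
  refine (SphereMetric (fun _ => conf (fun z => f (nsq z))) _ _ _ _).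
  - intros _ a b; now apply conf_smooth.
  - intros _ a b p; apply conf_sym.
  - intros _ p v; apply inner_conf_pos, f_pos, nsq_ge0.
  - rewrite <- rotation_0; now apply rotation_pulls_back.
Defined.

Lemma radial_metric_rotationally_invariant : rotationally_invariant radial_metric.
Proof.
  split.
  - intros i p; split; reflexivity.
  - intro theta; now apply rotation_pulls_back.
Qed.

End RadialMetric.

Lemma isometry_transports_curvature (g h : sphere_metric) f f1 f2 e e1 e2 phi i j p :
  (forall k, g k = conf (fun z => f (nsq z))) -> (forall k, h k = conf (fun z => e (nsq z))) ->
  twice_derivable f f1 f2 -> (forall s, 0 <= s -> 0 < f s) ->
  twice_derivable e e1 e2 -> (forall s, 0 <= s -> 0 < e s) ->
  smooth_map phi -> pulls_back phi h g -> dom j (phi (param i p)) ->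
  radial_curvature f f1 f2 (nsq p) = radial_curvature e e1 e2 (nsq (read_map phi i j p)).
Proof.
  intros Hg Hh Hf fpos He epos Hphi Hpull Hdom.
  destruct (Hphi i j p Hdom) as [Hloc Hsm].
  apply radial_curvature_isometry; auto.
  revert Hloc; apply filter_imp; intros q Hq a b.
  rewrite <- (Hg i), <- (Hh j); now apply Hpull.
Qed.

Lemma sphere_covered (P : sphere) : exists i p, P = param i p.
Proof.
  destruct P as [z|]; [now exists chart_z, z|].
  exists chart_w, (RtoC 0); unfold param; now rewrite sphere_inv_0.
Qed.

Lemma sphere_dom (P : sphere) : exists j, dom j P.
Proof. destruct P as [z|]; [exists chart_z | exists chart_w]; easy. Qed.

Lemma coord_equator j : dom j (Some (RtoC 1)) -> nsq (coord j (Some (RtoC 1))) = 1.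
Proof.
  intros _; assert (H1 : RtoC 1 <> RtoC 0) by (intro E; injection E; lra).
  assert (H2 : nsq (RtoC 1) = 1) by (unfold nsq; simpl; ring).
  destruct j; [exact H2|].
  unfold coord; rewrite sphere_inv_some by exact H1.
  rewrite nsq_Cinv, H2 by exact H1; apply Rinv_1.
Qed.

(** * Infinitely many metrics that are not isometric *)
Section Family.

Variables (l : nat) (c : R).
Hypothesis (hl : (1 <= l)%nat) (hc : c <> 0).

(** The first condition gives the positivity of [speed_sq], the second one that
    of the conformal factor. *)
Definition admissible (beta : R) : Prop :=
  0 < 1 + beta * INR l /\ 0 < (1 - beta) / c.

Lemma factor_inv beta s : admissible beta -> 0 < s ->
  factor l beta c (/ s) = s * s * factor l beta c s.
Proof. intros [Hb _] Hs; unfold factor; rewrite dens_inv by assumption; ring. Qed.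

Definition solution (beta : R) (H : admissible beta) : sphere_metric :=
  radial_metric (factor l beta c)
    (factor_smooth l beta c (proj1 H))
    (factor_pos l beta c (proj1 H) (proj2 H))
    (fun s => factor_inv beta s H).

Lemma tau_bounds beta s : admissible beta -> 0 <= s -> 0 <= s * dens l beta s <= 1.
Proof.
  intros [Hb _] Hs; pose proof (radius_sq_m2_neg l beta Hb) as N.
  rewrite dens_latitude by (try assumption; lra).
  apply tau_range; destruct (latitude_range l beta Hb s Hs); lra.
Qed.

Lemma tau_equator beta : admissible beta -> 1 * dens l beta 1 = 1.
Proof.
  intros [Hb _]; pose proof (radius_sq_m2_neg l beta Hb).
  rewrite dens_latitude by (try assumption; lra). rewrite latitude_1 by assumption; ring.
Qed.

Lemma pow_01 x n : 0 <= x <= 1 -> 0 <= x ^ n <= 1.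
Proof. intro H; induction n; simpl; nra. Qed.

Lemma curv_equator beta : admissible beta -> curv l beta c 1 = c + amplitude l beta c.
Proof. intro H; unfold curv; rewrite tau_equator, pow1 by assumption; ring. Qed.

Lemma curvature_solution beta H P :
  exists s, 0 <= s /\ curvature (solution beta H) P = curv l beta c s.
Proof.
  destruct H as [Hb Hs].
  assert (K : forall q, gauss_curvature (conf (fun z => factor l beta c (nsq z))) q = curv l beta c (nsq q)).
  { intro q; rewrite (gauss_curvature_radial _ _ _ (factor_twice_derivable l beta c Hb)).
    - apply factor_curvature; try assumption; apply nsq_ge0.
    - intros; now apply factor_pos. }
  destruct P as [z|]; [exists (nsq z) | exists (nsq (RtoC 0))]; (split; [apply nsq_ge0 | apply K]).
Qed.

Lemma curvature_solution_equator beta H :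
  curvature (solution beta H) (Some (RtoC 1)) = c + amplitude l beta c.
Proof.
  destruct H as [Hb Hs]; rewrite <- curv_equator by (split; assumption).
  transitivity (curv l beta c (nsq (RtoC 1))); [|f_equal; unfold nsq; simpl; ring].
  unfold curvature; simpl.
  rewrite (gauss_curvature_radial _ _ _ (factor_twice_derivable l beta c Hb)).
  - apply factor_curvature; try assumption; apply nsq_ge0.
  - intros; now apply factor_pos.
Qed.

Lemma solution_sign beta H eps :
  (eps = -1 \/ eps = 1) -> 0 < eps * amplitude l beta c ->
  has_sign (fun P => curvature (solution beta H) P - c) eps.
Proof.
  intros Heps Hamp.
  assert (Hne : exists P, curvature (solution beta H) P - c <> 0).
  { exists (Some (RtoC 1)); rewrite curvature_solution_equator.
    destruct Heps as [-> | ->]; lra. }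
  assert (Hb : forall P, 0 <= eps * (curvature (solution beta H) P - c)).
  { intro P; destruct (curvature_solution beta H P) as [s [Hs ->]].
    pose proof (pow_01 _ l (tau_bounds beta s H Hs)).
    unfold curv; nra. }
  destruct Heps as [-> | ->]; [right | left]; (split; [reflexivity | split; [|exact Hne]]);
    intro P; specialize (Hb P); lra.
Qed.

Lemma solution_correct beta H :
  rotationally_invariant (solution beta H) /\
  generalized_ricci (- 2 * INR l) 0 c (solution beta H).
Proof.
  split; [apply radial_metric_rotationally_invariant|].
  destruct H as [Hb Hs]; intro i; now apply factor_generalized_ricci.
Qed.

Lemma isometry_curv beta beta' H H' phi i j p :
  smooth_map phi -> pulls_back phi (solution beta' H') (solution beta H) ->
  dom j (phi (param i p)) ->
  curv l beta c (nsq p) = curv l beta' c (nsq (read_map phi i j p)).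
Proof.
  intros Hphi Hpull Hdom; destruct H as [Hb Hs], H' as [Hb' Hs'].
  rewrite <- !factor_curvature by (try assumption; apply nsq_ge0).
  apply (isometry_transports_curvature (solution beta (conj Hb Hs)) (solution beta' (conj Hb' Hs'))
    (factor l beta c) _ _ (factor l beta' c) _ _ phi i j p); try reflexivity; try assumption.
  - now apply factor_twice_derivable.
  - now apply factor_pos.
  - now apply factor_twice_derivable.
  - now apply factor_pos.
Qed.

(** [amplitude] is the extreme value of [K - c] and is attained on the equator.
    Following a point of the equator by the isometry and by its inverse
    compares the two extreme values in both directions. *)
Lemma isometric_amplitude beta beta' H H' eps :
  (eps = -1 \/ eps = 1) -> 0 < eps * amplitude l beta c -> 0 < eps * amplitude l beta' c ->
  isometric (solution beta H) (solution beta' H') -> amplitude l beta c = amplitude l beta' c.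
Proof.
  intros Heps Ha Ha' [phi [psi [_ [Hinv [Hphi [_ Hpull]]]]]].
  assert (Hbound : forall b, admissible b -> 0 < eps * amplitude l b c -> forall s, 0 <= s ->
     eps * (curv l b c s - c) <= eps * amplitude l b c).
  { intros b Hb Hab s Hs; pose proof (pow_01 _ l (tau_bounds b s Hb Hs)); unfold curv; nra. }
  assert (L1 : eps * amplitude l beta c <= eps * amplitude l beta' c).
  { destruct (sphere_dom (phi (param chart_z (RtoC 1)))) as [j Hj].
    pose proof (isometry_curv _ _ H H' phi chart_z j (RtoC 1) Hphi Hpull Hj) as E.
    pose proof (Hbound beta' H' Ha' _ (nsq_ge0 (read_map phi chart_z j (RtoC 1)))) as B.
    rewrite <- E in B.
    replace (nsq (RtoC 1)) with 1 in B by (unfold nsq; simpl; ring).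
    rewrite curv_equator in B by exact H. lra. }
  assert (L2 : eps * amplitude l beta' c <= eps * amplitude l beta c).
  { destruct (sphere_covered (psi (Some (RtoC 1)))) as [i [p Ep]].
    assert (Eq : phi (param i p) = Some (RtoC 1)) by (rewrite <- Ep; apply Hinv).
    destruct (sphere_dom (Some (RtoC 1))) as [j Hj].
    pose proof (isometry_curv _ _ H H' phi i j p Hphi Hpull) as E.
    rewrite Eq in E; specialize (E Hj).
    unfold read_map in E; rewrite Eq, coord_equator, curv_equator in E by assumption.
    pose proof (Hbound beta H Ha _ (nsq_ge0 p)) as B. rewrite E in B; lra. }
  destruct Heps as [-> | ->]; lra.
Qed.

Lemma amplitude_inj beta beta' : admissible beta -> admissible beta' ->
  amplitude l beta c = amplitude l beta' c -> beta = beta'.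
Proof.
  intros [_ H] [_ H'] E.
  pose proof (beta_neq1 beta c H) as N; pose proof (beta_neq1 beta' c H') as N'.
  pose proof (pos_INR l) as Pl.
  unfold amplitude in E.
  assert (Ec : (INR l + 1) * c <> 0) by (apply Rmult_integral_contrapositive; split; [lra | exact hc]).
  assert (E' : beta / (1 - beta) = beta' / (1 - beta')).
  { apply Rmult_eq_reg_l with ((INR l + 1) * c); [|exact Ec]. unfold Rdiv in *; lra. }
  apply (f_equal (fun x => x * ((1 - beta) * (1 - beta')))) in E'.
  field_simplify in E'; lra.
Qed.

End Family.

(** The amplitude has the sign of [beta], provided that [scale] is positive. If
    [c > 0], this requires [beta < 1], and both signs occur for small [beta];
    if [c < 0], it requires [beta > 1]. *)
Lemma parameter_family (l : nat) (c eps : R) :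
  (1 <= l)%nat -> c <> 0 -> (eps = -1 \/ eps = 1) -> (c < 0 -> eps = 1) ->
  exists beta : nat -> R,
    (forall n, admissible l c (beta n) /\ 0 < eps * amplitude l (beta n) c) /\
    (forall m n, beta m = beta n -> m = n).
Proof.
  intros hl hc heps hceps.
  assert (Hl : 1 <= INR l) by (apply (le_INR 1), hl).
  assert (Hn : forall n, 0 <= INR n) by apply pos_INR.
  assert (Amp : forall b, admissible l c b -> 0 < eps * b -> 0 < c -> 0 < eps * amplitude l b c).
  { intros b [_ Hb] Heb Hc. unfold amplitude.
    replace (eps * ((INR l + 1) * c * b / (1 - b))) with ((INR l + 1) * (eps * b) * / ((1 - b) / c))
     by (field; split; [intro Z; apply (beta_neq1 b c Hb Z) | lra]).
    apply Rmult_lt_0_compat; [apply Rmult_lt_0_compat; lra | now apply Rinv_0_lt_compat]. }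
  assert (Inv : forall n, 0 < / (INR n + 2) < 1).
  { intro n; specialize (Hn n); split; [apply Rinv_0_lt_compat; lra|].
    rewrite <- Rinv_1; apply Rinv_lt_contravar; lra. }
  destruct (Rtotal_order c 0) as [Hc|[Hc|Hc]]; [|contradiction|].
  - exists (fun n => INR n + 2); split.
    + intro n; specialize (Hn n); rewrite (hceps Hc).
      assert (Hq : 0 < (1 - (INR n + 2)) / c).
      { replace ((1 - (INR n + 2)) / c) with ((INR n + 1) * / (- c)) by (field; lra).
        apply Rmult_lt_0_compat; [lra | apply Rinv_0_lt_compat; lra]. }
      split; [split; [nra | exact Hq]|].
      unfold amplitude.
      replace (1 * ((INR l + 1) * c * (INR n + 2) / (1 - (INR n + 2))))
        with ((INR l + 1) * (INR n + 2) * / ((1 - (INR n + 2)) / c)) by (field; split; lra).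
      apply Rmult_lt_0_compat; [nra | now apply Rinv_0_lt_compat].
    + intros m n E; apply INR_eq; lra.
  - destruct heps as [-> | ->].
    + exists (fun n => - / (INR n + 2) * / INR l); split.
      * intro n; specialize (Inv n).
        assert (Hil : 0 < / INR l) by (apply Rinv_0_lt_compat; lra).
        assert (Ha : admissible l c (- / (INR n + 2) * / INR l)).
        { split.
          - replace (1 + - / (INR n + 2) * / INR l * INR l) with (1 - / (INR n + 2))
              by (field; specialize (Hn n); split; lra). lra.
          - apply Rdiv_lt_0_compat; [nra | exact Hc]. }
        split; [exact Ha | apply Amp; [exact Ha | nra | exact Hc]].
      * intros m n E; apply INR_eq.
        apply Rmult_eq_reg_r in E; [|apply Rinv_neq_0_compat; lra].
        apply Ropp_eq_compat in E; rewrite !Ropp_involutive in E.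
        apply Rinv_eq_reg in E; lra.
    + exists (fun n => / (INR n + 2)); split.
      * intro n; specialize (Inv n).
        assert (Ha : admissible l c (/ (INR n + 2))).
        { split; [nra | apply Rdiv_lt_0_compat; lra]. }
        split; [exact Ha | apply Amp; [exact Ha | lra | exact Hc]].
      * intros m n E; apply INR_eq; apply Rinv_eq_reg in E; lra.
Qed.

Theorem proposition5p9 (l : nat) (c eps : R)
  (hl : (1 <= l)%nat) (hc : c <> 0) (heps : eps = -1 \/ eps = 1)
  (hceps : c < 0 -> eps = 1) :
  (exists g : sphere_metric,
      rotationally_invariant g /\
      generalized_ricci (- 2 * INR l) 0 c g /\
      has_sign (fun P => curvature g P - c) eps) /\
  (exists G : nat -> sphere_metric,
      (forall n, rotationally_invariant (G n) /\
                 generalized_ricci (- 2 * INR l) 0 c (G n) /\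
                 has_sign (fun P => curvature (G n) P - c) eps) /\
      (forall m n, m <> n -> ~ isometric (G m) (G n))).
Proof.
  destruct (parameter_family l c eps hl hc heps hceps) as [beta [Hbeta Hinj]].
  set (G := fun n => solution l c (beta n) (proj1 (Hbeta n))).
  assert (HG : forall n, rotationally_invariant (G n) /\
                 generalized_ricci (- 2 * INR l) 0 c (G n) /\
                 has_sign (fun P => curvature (G n) P - c) eps).
  { intro n; destruct (solution_correct l c hl hc (beta n) (proj1 (Hbeta n))) as [H1 H2].
    split; [exact H1 | split; [exact H2|]].
    apply solution_sign; [exact hc | exact heps | exact (proj2 (Hbeta n))]. }
  split; [exists (G 0%nat); apply HG|].
  exists G; split; [exact HG|].
  intros m n Hmn Hiso; apply Hmn, Hinj.
  apply (amplitude_inj l c hc); try apply Hbeta.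
  exact (isometric_amplitude l c hc _ _ _ _ eps heps (proj2 (Hbeta m)) (proj2 (Hbeta n)) Hiso).
Qed.
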